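(* Let $F$ be an infinite field of positive characteristic, and let $\mathcal V$ be a non-prime variety of associative $F$-algebras. Then $\mathcal V$ is almost Lie nilpotent if and only if $\mathcal V$ is generated either by the algebra $A(C)$ or by the algebra $A(C)^{\star}$.
   Context: All algebras are associative, not necessarily unital. $F\langle X\rangle$ is the free (non-unital) associative $F$-algebra on a countable set $X$; its elements are called polynomials. A variety of $F$-algebras is the class of all $F$-algebras satisfying some given set of polynomial identities; the variety generated by an algebra is the smallest variety containing it. For a variety $\mathcal V$, $T(\mathcal V)$ is the ideal of all polynomials $f$ such that $f=0$ is an identity of $\mathcal V$. A T-ideal is an ideal of $F\langle X\rangle$ closed under all endomorphisms of $F\langle X\rangle$. A variety $\mathcal V$ is prime (verbally prime) if for all T-ideals $I_1,I_2$ the inclusion $I_1\cdot I_2\subseteq T(\mathcal V)$ implies $I_1\subseteq T(\mathcal V)$ or $I_2\subseteq T(\mathcal V)$; otherwise it is non-prime. Put $[x,y]=xy-yx$, $W_2(x_1,x_2)=[x_1,x_2]$ and $W_n(x_1,\dots,x_n)=[W_{n-1}(x_1,\dots,x_{n-1}),x_n]$. A variety is Lie nilpotent if it satisfies the identity $W_n(x_1,\dots,x_n)=0$ for some $n$. A variety is almost Lie nilpotent if it is not Lie nilpotent but all its proper subvarieties are Lie nilpotent. $C$ denotes the (non-unital) $F$-algebra generated by $c_1,c_2,\dots$ with defining relations $c_ic_j=c_jc_i$, $c_i^2=0$ for $i,j=1,2,\dots$. For an $F$-algebra $U$, $A(U)$ is the algebra of all matrices $\begin{pmatrix} u & v\\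 0&0\end{pmatrix}$ with $u,v\in U$, under matrix operations. $A^{\star}$ denotes the algebra anti-isomorphic (opposite) to $A$. *)

(* Defs.v *)
From HB Require Import structures.
From mathcomp Require Import all_boot all_order all_algebra.
From mathcomp Require Import finmap monalg.
From mathcomp Require Import boolp classical_sets cardinality.

Set Implicit Arguments.
Unset Strict Implicit.
Unset Printing Implicit Defensive.

Import GRing.Theory.
Local Open Scope classical_set_scope.
Local Open Scope ring_scope.
Local Open Scope quotient_scope.

Reserved Notation "x ** y" (at level 40, left associativity).

HB.mixin Record Lmodule_isNUAlgebra (F : fieldType) A of GRing.Lmodule F A := {
  nmul : A -> A -> A;
  nmulA : associative nmul;
  nmulDl : left_distributive nmul +%R;
  nmulDr : right_distributive nmul +%R;
  nscalerAl : forall (k : F) (x y : A), k *: nmul x y = nmul (k *: x) y;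
  nscalerAr : forall (k : F) (x y : A), k *: nmul x y = nmul x (k *: y)
}.

(* Associative, not necessarily unital; the zero algebra is allowed. *)
#[short(type="nualgType")]
HB.structure Definition NUAlgebra (F : fieldType) :=
  { A of GRing.Lmodule F A & Lmodule_isNUAlgebra F A }.

Notation "x ** y" := (nmul x y) : ring_scope.

Section NUAlgebraTheory.
Variables (F : fieldType) (A : nualgType F).
Implicit Types (x y : A) (S : set A).

Definition ncomm x y : A := x ** y - y ** x.

Definition is_ideal (I : set A) : Prop :=
  [/\ I 0, forall x y, I x -> I y -> I (x + y),
      forall (k : F) x, I x -> I (k *: x)
    & forall x y, I x -> I (x ** y) /\ I (y ** x)].

Definition ideal_gen S : set A :=
  fun x => forall I : set A, is_ideal I -> S `<=` I -> I x.

Lemma ideal_gen_ideal S : is_ideal (ideal_gen S).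
Proof.
split.
- by move=> I [].
- by move=> x y Sx Sy I idI SI; case: (idI) => _ + _ _; apply; [apply: Sx|apply: Sy].
- by move=> k x Sx I idI SI; case: (idI) => _ _ + _; apply; apply: Sx.
- by move=> x y Sx; split=> I idI SI; case: (idI) => _ _ _ /(_ x y) [] //; apply: Sx.
Qed.

Definition ideal_pred S : {pred A} := fun x => `[< ideal_gen S x >].

Lemma ideal_predE S x : (x \in ideal_pred S) = `[< ideal_gen S x >].
Proof. by []. Qed.

Fact ideal_pred_zmod_closed S : zmod_closed (ideal_pred S).
Proof.
have [I0 ID IZ _] := ideal_gen_ideal S; split; first exact/asboolP.
move=> x y; rewrite !ideal_predE => /asboolP Ix /asboolP Iy; apply/asboolP.
by apply: ID => //; rewrite -scaleN1r; apply: IZ.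
Qed.

HB.instance Definition _ S :=
  GRing.isZmodClosed.Build A (ideal_pred S) (ideal_pred_zmod_closed S).

End NUAlgebraTheory.

Definition is_nuhom (F : fieldType) (A B : nualgType F) (h : A -> B) : Prop :=
  linear h /\ {morph h : x y / x ** y}.

Section Quotient.
Variables (F : fieldType) (A : nualgType F) (S : set A).

Definition quot_alg : Type := Quotient.quot (ideal_pred S).

HB.instance Definition _ := GRing.Zmodule.on quot_alg.

Definition quot_proj (x : A) : quot_alg := \pi_(Quotient.quot (ideal_pred S)) x.

Lemma quot_projP x y : quot_proj x = quot_proj y <-> ideal_gen S (x - y).
Proof.
rewrite /quot_proj; split=> [/eqP|h].
  by rewrite -Quotient.idealrBE => /asboolP.
by apply/eqP; rewrite -Quotient.idealrBE; apply/asboolP.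
Qed.

Definition quot_repr (x : quot_alg) : A := repr (x : Quotient.quot (ideal_pred S)).

Lemma quot_proj_repr x : quot_proj (quot_repr x) = x.
Proof. exact: reprK. Qed.

Lemma quot_projD : {morph quot_proj : x y / x + y}.
Proof. by move=> x y; rewrite /quot_proj !piE. Qed.

Definition quot_scale (k : F) (x : quot_alg) : quot_alg :=
  quot_proj (k *: quot_repr x).

Definition quot_mul (x y : quot_alg) : quot_alg := quot_proj (quot_repr x ** quot_repr y).

Lemma quot_projZ k x : quot_proj (k *: x) = quot_scale k (quot_proj x).
Proof.
have [_ _ IZ _] := ideal_gen_ideal S.
apply/quot_projP; rewrite -scalerBr; apply: IZ; apply/quot_projP.
by rewrite quot_proj_repr.
Qed.

Lemma quot_projM x y : quot_proj (x ** y) = quot_mul (quot_proj x) (quot_proj y).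
Proof.
have [_ ID IZ IM] := ideal_gen_ideal S.
apply/quot_projP; set x' := quot_repr _; set y' := quot_repr _.
have -> : x ** y - x' ** y' = (x - x') ** y + x' ** (y - y').
  rewrite nmulDl nmulDr -!scaleN1r -nscalerAl -nscalerAr !scaleN1r.
  by rewrite addrA subrK.
apply: ID; first by apply: (IM _ _ _).1; apply/quot_projP; rewrite quot_proj_repr.
by apply: (IM _ _ _).2; apply/quot_projP; rewrite quot_proj_repr.
Qed.

Lemma quot_ind (P : quot_alg -> Prop) : (forall x, P (quot_proj x)) -> forall x, P x.
Proof. by move=> h x; rewrite -(quot_proj_repr x). Qed.

Fact quot_scaleA k l x : quot_scale k (quot_scale l x) = quot_scale (k * l) x.
Proof. by elim/quot_ind: x => x; rewrite -!quot_projZ scalerA. Qed.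

Fact quot_scale1 : left_id 1 quot_scale.
Proof. by elim/quot_ind=> x; rewrite -!quot_projZ scale1r. Qed.

Fact quot_scaleDr : right_distributive quot_scale +%R.
Proof.
move=> k; elim/quot_ind=> x; elim/quot_ind=> y.
by rewrite -!(quot_projD, quot_projZ) scalerDr.
Qed.

Fact quot_scaleDl x : {morph quot_scale^~ x : k l / k + l}.
Proof.
by move=> k l; elim/quot_ind: x => x; rewrite /= -!quot_projZ -quot_projD scalerDl.
Qed.

HB.instance Definition _ := GRing.Zmodule_isLmodule.Build F quot_alg
  quot_scaleA quot_scale1 quot_scaleDr quot_scaleDl.

Fact quot_mulA : associative quot_mul.
Proof.
elim/quot_ind=> x; elim/quot_ind=> y; elim/quot_ind=> z.
by rewrite -!quot_projM nmulA.
Qed.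

Fact quot_mulDl : left_distributive quot_mul +%R.
Proof.
elim/quot_ind=> x; elim/quot_ind=> y; elim/quot_ind=> z.
by rewrite -!(quot_projD, quot_projM) nmulDl.
Qed.

Fact quot_mulDr : right_distributive quot_mul +%R.
Proof.
elim/quot_ind=> x; elim/quot_ind=> y; elim/quot_ind=> z.
by rewrite -!(quot_projD, quot_projM) nmulDr.
Qed.

Fact quot_scaleAl (k : F) (x y : quot_alg) :
  k *: quot_mul x y = quot_mul (k *: x) y.
Proof.
elim/quot_ind: x => x; elim/quot_ind: y => y.
rewrite -quot_projM; change (quot_scale k (quot_proj (x ** y)) =
  quot_mul (quot_scale k (quot_proj x)) (quot_proj y)).
by rewrite -!(quot_projZ, quot_projM) nscalerAl.
Qed.

Fact quot_scaleAr (k : F) (x y : quot_alg) :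
  k *: quot_mul x y = quot_mul x (k *: y).
Proof.
elim/quot_ind: x => x; elim/quot_ind: y => y.
rewrite -quot_projM; change (quot_scale k (quot_proj (x ** y)) =
  quot_mul (quot_proj x) (quot_scale k (quot_proj y))).
by rewrite -!(quot_projZ, quot_projM) nscalerAr.
Qed.

HB.instance Definition _ := Lmodule_isNUAlgebra.Build F quot_alg
  quot_mulA quot_mulDl quot_mulDr quot_scaleAl quot_scaleAr.

End Quotient.

(* The free non-unital algebra F<X>, X = {x_0, x_1, ...}: the elements of the
   free unital algebra (the monoid algebra of words over nat) whose
   coefficient at the empty word is zero. *)
Section FreeAlgebra.
Variable F : fieldType.

Definition aug_pred : {pred {malg F[{fmonom nat}]}} := fun f => mcoeff mone f == 0.

Fact aug_submod_closed : submod_closed aug_pred.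
Proof.
split=> [|k f g]; rewrite !unfold_in ?mcoeff0 //.
by move=> /eqP f0 /eqP g0; rewrite mcoeffD mcoeffZ f0 g0 mulr0 addr0.
Qed.

HB.instance Definition _ := GRing.isSubmodClosed.Build F {malg F[{fmonom nat}]}
  aug_pred aug_submod_closed.

Record fpoly : predArgType :=
  FPoly { fpoly_val :> {malg F[{fmonom nat}]}; fpolyP : fpoly_val \in aug_pred }.

HB.instance Definition _ := [isSub for fpoly_val].
HB.instance Definition _ := [Choice of fpoly by <:].
HB.instance Definition _ := [SubChoice_isSubLmodule of fpoly by <:].

Fact fpoly_mulP (f g : fpoly) : (fpoly_val f * fpoly_val g) \in aug_pred.
Proof.
rewrite unfold_in rmorphM /=; have /eqP -> := fpolyP f.
by rewrite mul0r.
Qed.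

Definition fpoly_mul (f g : fpoly) : fpoly := FPoly (fpoly_mulP f g).

Fact fpoly_mulA : associative fpoly_mul.
Proof. by move=> f g h; apply: val_inj; rewrite /= mulrA. Qed.

Fact fpoly_mulDl : left_distributive fpoly_mul +%R.
Proof. by move=> f g h; apply: val_inj; rewrite /= mulrDl. Qed.

Fact fpoly_mulDr : right_distributive fpoly_mul +%R.
Proof. by move=> f g h; apply: val_inj; rewrite /= mulrDr. Qed.

Fact fpoly_scaleAl (k : F) (f g : fpoly) :
  k *: fpoly_mul f g = fpoly_mul (k *: f) g.
Proof. by apply: val_inj; rewrite /= scalerAl. Qed.

Fact malg_scalerAr (k : F) (f g : {malg F[{fmonom nat}]}) :
  k *: (f * g) = f * (k *: g).
Proof.
apply/malgP=> w; rewrite mcoeffZ mcoeffMl.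
rewrite (mcoeffMlw _ (fsubset_refl _) (msuppZ_le k g)) mulr_sumr.
apply: eq_bigr => u _; rewrite mulr_sumr; apply: eq_bigr => v _.
by rewrite mcoeffZ mulrnAr mulrCA.
Qed.

Fact fpoly_scaleAr (k : F) (f g : fpoly) :
  k *: fpoly_mul f g = fpoly_mul f (k *: g).
Proof. by apply: val_inj; rewrite /= malg_scalerAr. Qed.

HB.instance Definition _ := Lmodule_isNUAlgebra.Build F fpoly
  fpoly_mulA fpoly_mulDl fpoly_mulDr fpoly_scaleAl fpoly_scaleAr.

Fact fvarP i : (<< fmu i >> : {malg F[{fmonom nat}]}) \in aug_pred.
Proof. by rewrite unfold_in mcoeffU1 fm1_eq1. Qed.

Definition fvar (i : nat) : fpoly := FPoly (fvarP i).

End FreeAlgebra.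

(* A class of algebras; `set` cannot be used here, for universe reasons. *)
Definition algclass (F : fieldType) := nualgType F -> Prop.

Section Identities.
Variable F : fieldType.

Definition subclass (V W : algclass F) : Prop := forall A, V A -> W A.

(* The value a_{i1} a_{i2} ... a_{ik} of a nonempty word; the empty word, which
   never occurs in an element of F<X>, gets the junk value 0. *)
Definition word_eval (A : nualgType F) (a : nat -> A) (w : seq nat) : A :=
  if w is i :: w' then foldl (fun x j => x ** a j) (a i) w' else 0.

Definition feval (A : nualgType F) (a : nat -> A) (f : fpoly F) : A :=
  \sum_(w <- msupp (fpoly_val f)) mcoeff w (fpoly_val f) *: word_eval a w.

Definition identity_of (A : nualgType F) (f : fpoly F) : Prop :=
  forall a : nat -> A, feval a f = 0.

Definition is_variety (V : algclass F) : Prop :=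
  exists S : set (fpoly F),
    forall A, V A <-> (forall f, S f -> identity_of A f).

Definition T_of (V : algclass F) : set (fpoly F) :=
  fun f => forall A, V A -> identity_of A f.

Definition generated_by (V : algclass F) (A : nualgType F) : Prop :=
  [/\ is_variety V, V A & forall W, is_variety W -> W A -> subclass V W].

Definition is_Tideal (I : set (fpoly F)) : Prop :=
  is_ideal I /\
  forall h : fpoly F -> fpoly F, is_nuhom h -> forall f, I f -> I (h f).

Definition ideal_prod (I J : set (fpoly F)) : set (fpoly F) :=
  fun f => exists2 s : seq (fpoly F * fpoly F),
    (forall q, q \in s -> I q.1 /\ J q.2) & f = \sum_(q <- s) q.1 ** q.2.

Definition prime_variety (V : algclass F) : Prop :=
  forall I J, is_Tideal I -> is_Tideal J ->
    ideal_prod I J `<=` T_of V -> I `<=` T_of V \/ J `<=` T_of V.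

(* The index is shifted: lieW n is W_{n+2}(x_0, ..., x_{n+1}). *)
Fixpoint lieW (n : nat) : fpoly F :=
  if n is m.+1 then ncomm (lieW m) (fvar F m.+2)
  else ncomm (fvar F 0) (fvar F 1).

Definition lie_nilpotent (V : algclass F) : Prop :=
  exists n, T_of V (lieW n).

Definition almost_lie_nilpotent (V : algclass F) : Prop :=
  ~ lie_nilpotent V /\
  forall W, is_variety W -> subclass W V -> ~ subclass V W -> lie_nilpotent W.

End Identities.

Section AlgebraC.
Variable F : fieldType.

Definition relsC : set (fpoly F) :=
  [set f | (exists i j, f = fvar F i ** fvar F j - fvar F j ** fvar F i)
           \/ (exists i, f = fvar F i ** fvar F i)].

Definition algC_sqz : nualgType F := quot_alg relsC.

End AlgebraC.

(* The pair (u, v) stands for the matrix with first row (u, v) and second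
   row (0, 0). *)
Section MatrixAlgebra.
Variables (F : fieldType) (U : nualgType F).

Definition rowmat : Type := (U * U)%type.

HB.instance Definition _ := GRing.Lmodule.on rowmat.

Definition rowmat_mul (x y : rowmat) : rowmat := (x.1 ** y.1, x.1 ** y.2).

Fact rowmat_mulA : associative rowmat_mul.
Proof. by move=> x y z; rewrite /rowmat_mul /= !nmulA. Qed.

Fact rowmat_mulDl : left_distributive rowmat_mul +%R.
Proof. by move=> x y z; rewrite /rowmat_mul /= !nmulDl. Qed.

Fact rowmat_mulDr : right_distributive rowmat_mul +%R.
Proof. by move=> x y z; rewrite /rowmat_mul /= !nmulDr. Qed.

Fact rowmat_scaleAl (k : F) (x y : rowmat) :
  k *: rowmat_mul x y = rowmat_mul (k *: x) y.
Proof. by rewrite /rowmat_mul /= -!nscalerAl. Qed.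

Fact rowmat_scaleAr (k : F) (x y : rowmat) :
  k *: rowmat_mul x y = rowmat_mul x (k *: y).
Proof. by rewrite /rowmat_mul /= -!nscalerAr. Qed.

HB.instance Definition _ := Lmodule_isNUAlgebra.Build F rowmat
  rowmat_mulA rowmat_mulDl rowmat_mulDr rowmat_scaleAl rowmat_scaleAr.

Definition algA : nualgType F := rowmat.

End MatrixAlgebra.

Section Opposite.
Variables (F : fieldType) (A : nualgType F).

Definition opposite : Type := A.

HB.instance Definition _ := GRing.Lmodule.on opposite.

Definition opp_mul (x y : opposite) : opposite := (y : A) ** (x : A).

Fact opp_mulA : associative opp_mul.
Proof. by move=> x y z; rewrite /opp_mul nmulA. Qed.

Fact opp_mulDl : left_distributive opp_mul +%R.
Proof. by move=> x y z; apply: (@nmulDr F A). Qed.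

Fact opp_mulDr : right_distributive opp_mul +%R.
Proof. by move=> x y z; apply: (@nmulDl F A). Qed.

Fact opp_scaleAl (k : F) (x y : opposite) : k *: opp_mul x y = opp_mul (k *: x) y.
Proof. exact: (@nscalerAr F A). Qed.

Fact opp_scaleAr (k : F) (x y : opposite) : k *: opp_mul x y = opp_mul x (k *: y).
Proof. exact: (@nscalerAl F A). Qed.

HB.instance Definition _ := Lmodule_isNUAlgebra.Build F opposite
  opp_mulA opp_mulDl opp_mulDr opp_scaleAl opp_scaleAr.

Definition algOpp : nualgType F := opposite.

End Opposite.

(* Main.v *)
Require Import Defs.
From mathcomp Require Import all_boot all_order all_algebra.
From mathcomp Require Import finmap monalg.
From mathcomp Require Import boolp classical_sets cardinality.

(** Let x_1, ..., x_n and m be distinct variables, and let f be multilinear in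
    them. Call lead f the sum of the coefficients of those monomials of f that
    end in m. In A(C) the letters in front of the last one commute, and C has
    a basis of square-free monomials. Hence a polynomial which is not an
    identity of A(C) has, over an infinite field, a multilinear consequence f
    with lead f <> 0 (multilinear_consequence); for the opposite algebra the
    same holds with the roles of left and right exchanged.

    If V is generated by A(C), it satisfies [x, y] z = 0, and a proper
    subvariety also satisfies such an f. At m = [y, z] all monomials with a
    letter after m vanish, so f becomes lead f times x_1 ... x_n [y, z], which
    up to sign is a left-normed commutator (kills_lie_nil). On the other hand
    A(C) is not Lie nilpotent, as no product of distinct generators of C is
    zero.

    Conversely let V be non-prime and almost Lie nilpotent, and suppose that it
    contains neither A(C) nor its opposite. The relatively free algebra R of V
    then satisfies an f as above and an analogous g for the other side. By
    minimality of V, every nonzero fully invariant ideal of R contains the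
    values of some W_n; in particular so do two such ideals with zero product,
    which exist because V is not prime. Hence the values of some W_k annihilate
    a nonzero fully invariant ideal M on both sides, and k is lowered as long
    as possible (annihilableS), replacing M by smaller ideals:

    - the values z of W_(k-1) act centrally on M, and comparing f at x_i = z z'
      with f at x_i = z removes the variables x_i one by one and leaves
      z [z', m] = 0; with g one gets [z', m] z = 0, and finally [z, m] = 0 on a
      smaller M (ncomm_reduction);
    - if k > 3, then z [[a, b], c] m = 0, so z z' m = 0 and W_(k-1) annihilates
      a nonzero ideal (lie_value_mul_lie3);
    - if k = 3, then m |-> [y, [x, m]] is linear over R, and
        f(yx) - f(x) y - f(y) x + f(1) x y = [y, [x, a]],
        f([x, y]) = [x, y] f(1),
      where the argument is the value of one x_i and a collects the monomials
      with x_i on the left of m, deleted; so either commutators annihilate a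
      nonzero ideal, or [y, [x, m]] = 0 on one (dcomm_reduction).

    An identity [x, m] = 0 or [y, [x, m]] = 0 on a nonzero ideal, which contains
    the values of some W_n, makes R Lie nilpotent: a contradiction. So V contains
    A(C) or its opposite, and is generated by it by minimality. *)

Set Implicit Arguments.
Unset Strict Implicit.
Unset Printing Implicit Defensive.

Import GRing.Theory.
Local Open Scope classical_set_scope.
Local Open Scope ring_scope.

(** * Commutator calculus in non-unital algebras *)

Section Calculus.
Variables (F : fieldType) (A : nualgType F).
Implicit Types (x y z a b r m : A) (M : set A).

Lemma nmul0l x : 0 ** x = 0 :> A.
Proof. by apply: (addrI (0 ** x)); rewrite -nmulDl !addr0. Qed.

Lemma nmul0r x : x ** 0 = 0 :> A.
Proof. by apply: (addrI (x ** 0)); rewrite -nmulDr !addr0. Qed.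

Lemma nmulNl x y : (- x) ** y = - (x ** y).
Proof. by rewrite -!scaleN1r -nscalerAl. Qed.

Lemma nmulNr x y : x ** (- y) = - (x ** y).
Proof. by rewrite -!scaleN1r -nscalerAr. Qed.

Lemma nmulBl x y z : (x - y) ** z = x ** z - y ** z.
Proof. by rewrite nmulDl nmulNl. Qed.

Lemma nmulBr x y z : x ** (y - z) = x ** y - x ** z.
Proof. by rewrite nmulDr nmulNr. Qed.

Lemma nmul_sumr I (s : seq I) (P : pred I) (f : I -> A) x :
  x ** (\sum_(i <- s | P i) f i) = \sum_(i <- s | P i) x ** f i.
Proof. exact: (big_morph _ (fun a b => nmulDr x a b) (nmul0r x)). Qed.

Lemma nmul_suml I (s : seq I) (P : pred I) (f : I -> A) x :
  (\sum_(i <- s | P i) f i) ** x = \sum_(i <- s | P i) f i ** x.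
Proof. exact: (big_morph (fun a => a ** x) (fun a b => nmulDl a b x) (nmul0l x)). Qed.

Lemma ncommC x y : ncomm x y = - ncomm y x.
Proof. by rewrite /ncomm opprB. Qed.

Lemma ncomm0r x : ncomm x 0 = 0 :> A.
Proof. by rewrite /ncomm nmul0l nmul0r subrr. Qed.

Lemma ncommDr x y z : ncomm x (y + z) = ncomm x y + ncomm x z.
Proof. by rewrite /ncomm nmulDl nmulDr opprD addrACA. Qed.

Lemma ncommZr (k : F) x y : ncomm x (k *: y) = k *: ncomm x y.
Proof. by rewrite /ncomm -nscalerAl -nscalerAr scalerBr. Qed.

Lemma ncommMr x y z : ncomm x (y ** z) = ncomm x y ** z + y ** ncomm x z.
Proof. by rewrite /ncomm nmulBl nmulBr !nmulA addrA subrK. Qed.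

Lemma ncommMl x y z : ncomm (y ** z) x = ncomm y x ** z + y ** ncomm z x.
Proof. by rewrite ncommC ncommMr opprD -nmulNl -nmulNr -!ncommC. Qed.

Lemma ncommDl x y z : ncomm (x + y) z = ncomm x z + ncomm y z.
Proof. by rewrite ncommC ncommDr opprD -!ncommC. Qed.

Lemma ncomm_eq x y : ncomm x y = 0 -> x ** y = y ** x.
Proof. by move/eqP; rewrite subr_eq0 => /eqP. Qed.

Lemma eq_ncomm x y : x ** y = y ** x -> ncomm x y = 0.
Proof. by move=> e; rewrite /ncomm e subrr. Qed.

Lemma ncomm2E y x h :
  ncomm y (ncomm x h) =
  y ** x ** h - x ** h ** y - y ** h ** x + h ** x ** y.
Proof.
rewrite /ncomm nmulBr nmulBl !nmulA opprB -!addrA; congr (_ + _).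
by rewrite [in RHS]addrCA; congr (_ + _); rewrite addrC.
Qed.

Lemma ncomm_jacobi a x y :
  ncomm a (ncomm x y) = ncomm (ncomm a x) y - ncomm (ncomm a y) x.
Proof.
rewrite [ncomm x y]/ncomm ncommDr -scaleN1r ncommZr scaleN1r !ncommMr opprD.
by rewrite [- _ - _]addrC addrACA [ncomm (ncomm a y) x]/ncomm opprB.
Qed.

End Calculus.

(** * Homomorphisms *)

Section Homs.
Variables (F : fieldType) (A B : nualgType F) (h : A -> B).
Implicit Types (x y : A).
Hypothesis homh : is_nuhom h.

Lemma nuhomM x y : h (x ** y) = h x ** h y.
Proof. by case: homh. Qed.

Lemma nuhom0 : h 0 = 0.
Proof.
case: homh => lh _; move: (lh (-1) 0 0).
by rewrite !scaler0 addr0 scaleN1r addNr.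
Qed.

Lemma nuhomD x y : h (x + y) = h x + h y.
Proof. by case: homh => lh _; rewrite -[x in LHS]scale1r lh scale1r. Qed.

Lemma nuhomZ (k : F) x : h (k *: x) = k *: h x.
Proof. by case: homh => lh _; rewrite -[_ *: _ in LHS]addr0 lh nuhom0 addr0. Qed.

Lemma nuhomB x y : h (x - y) = h x - h y.
Proof. by rewrite nuhomD -scaleN1r nuhomZ scaleN1r. Qed.

Lemma nuhom_ncomm x y : h (ncomm x y) = ncomm (h x) (h y).
Proof. by rewrite nuhomB !nuhomM. Qed.

Lemma nuhom_sum I (s : seq I) (P : pred I) (f : I -> A) :
  h (\sum_(i <- s | P i) f i) = \sum_(i <- s | P i) h (f i).
Proof. exact: (big_morph h nuhomD nuhom0). Qed.
End Homs.

Lemma nuhom_id (F : fieldType) (A : nualgType F) : is_nuhom (@id A).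
Proof. by split. Qed.

Lemma nuhom_comp (F : fieldType) (A B C : nualgType F) (h : A -> B) (g : B -> C) :
  is_nuhom h -> is_nuhom g -> is_nuhom (g \o h).
Proof.
move=> hh hg; split=> [k x y|x y] /=; last by rewrite (nuhomM hh) (nuhomM hg).
by rewrite (nuhomD hh) (nuhomZ hh) (nuhomD hg) (nuhomZ hg).
Qed.

(** * Fully invariant ideals *)

Section Invariance.
Variables (F : fieldType) (A : nualgType F).
Implicit Types (x y z a b r m : A) (M : set A).

Definition endo_ideal M : Prop :=
  is_ideal M /\ forall h : A -> A, is_nuhom h -> forall x, M x -> M (h x).

Definition nontrivial M : Prop := exists2 m, M m & m <> 0.

Section EndoIdeal.
Variables (M : set A).
Hypothesis idM : is_ideal M.

Lemma idealD x y : M x -> M y -> M (x + y).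
Proof. by case: idM => _ + _ _; apply. Qed.

Lemma idealZ (k : F) x : M x -> M (k *: x).
Proof. by case: idM => _ _ + _; apply. Qed.

Lemma idealN x : M x -> M (- x).
Proof. by move=> Mx; rewrite -scaleN1r; apply: idealZ. Qed.

Lemma idealB x y : M x -> M y -> M (x - y).
Proof. by move=> Mx My; apply: idealD => //; apply: idealN. Qed.

Lemma ideal_mull x y : M y -> M (x ** y).
Proof. by case: idM => _ _ _ /(_ y x) + My => -[]. Qed.

Lemma ideal_mulr x y : M x -> M (x ** y).
Proof. by case: idM => _ _ _ /(_ x y) + Mx => -[]. Qed.

Lemma ideal_ncomm x y : M x -> M (ncomm x y).
Proof. by move=> Mx; apply: idealB; [apply: ideal_mulr|apply: ideal_mull]. Qed.

Lemma ideal_sum I (s : seq I) (P : pred I) (f : I -> A) :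
  (forall i, P i -> M (f i)) -> M (\sum_(i <- s | P i) f i).
Proof.
by move=> Mf; elim/big_ind: _ => //; [case: idM | apply: idealD].
Qed.
End EndoIdeal.

(** Requiring P of all endomorphic images of m makes this set fully invariant.
    In the arguments below a nonzero core is obtained from one nonzero value
    of a polynomial all of whose values satisfy P. *)
Definition endo_core M (P : A -> Prop) : set A :=
  [set m | M m /\ forall h : A -> A, is_nuhom h -> P (h m)].

Lemma endo_coreP M P m : endo_core M P m -> P m.
Proof. by case=> _ /(_ _ (nuhom_id A)). Qed.

Lemma endo_core_ideal M P : endo_ideal M ->
  P 0 -> (forall x y, P x -> P y -> P (x + y)) ->
  (forall (k : F) x, P x -> P (k *: x)) ->
  (forall r m, M m -> P m -> P (r ** m) /\ P (m ** r)) ->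
  endo_ideal (endo_core M P).
Proof.
move=> [idM endoM] P0 PD PZ PM; split; first split.
- by split=> [|h hh]; [case: idM | rewrite (nuhom0 hh)].
- move=> x y [Mx Px] [My Py]; split=> [|h hh]; first exact: idealD.
  by rewrite (nuhomD hh) //; apply: PD; [apply: Px|apply: Py].
- move=> k x [Mx Px]; split=> [|h hh]; first exact: idealZ.
  by rewrite (nuhomZ hh) //; apply: PZ; apply: Px.
- move=> m r [Mm Pm]; split;
    (split=> [|h hh]; [by [apply: ideal_mulr | apply: ideal_mull]|]);
  by rewrite (nuhomM hh) //; case: (PM (h r) (h m) (endoM h hh m Mm) (Pm h hh)).
move=> h hh m [Mm Pm]; split; first exact: endoM.
by move=> g hg; exact: (Pm _ (nuhom_comp hh hg)).
Qed.

(** The values of the left-normed commutator W_(n+1), where W_1 = x_1. *)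
Fixpoint lie_value n : set A :=
  if n is k.+1 then [set r | exists a b, lie_value k a /\ r = ncomm a b]
  else setT.

Lemma lie_valueS k a b : lie_value k a -> lie_value k.+1 (ncomm a b).
Proof. by move=> va; exists a, b. Qed.

Lemma lie_value_hom h n r : is_nuhom h -> lie_value n r -> lie_value n (h r).
Proof.
move=> hh; elim: n r => //= n IH r [a [b [va ->]]].
by exists (h a), (h b); rewrite (nuhom_ncomm hh); split=> //; apply: IH.
Qed.

Lemma lie_value_le n d r : lie_value (n + d) r -> lie_value n r.
Proof.
elim: n r => [//|n IH] r /= [a [b [va ->]]].
by exists a, b; split=> //; apply: IH.
Qed.

Lemma ideal_lie_value M n d : is_ideal M ->
  lie_value n `<=` M -> lie_value (n + d) `<=` M.
Proof.
move=> idM Mn; elim: d => [|d IH]; first by rewrite addn0.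
by rewrite addnS => r /= [a [b [/IH Ma ->]]]; apply: ideal_ncomm.
Qed.

Definition lie_nil : Prop := exists n, lie_value n `<=` [set 0].

End Invariance.

(** * Multilinear polynomials with a distinguished variable *)

Section Terms.
Variable F : fieldType.

(** (c, (u, v)) stands for c x_u m x_v, with m a distinguished variable. *)
Definition mterm : Type := (F * (seq nat * seq nat))%type.

Implicit Types (f : seq mterm) (u v s : seq nat) (i : nat).

Definition multilinear s f : bool := all (fun t => perm_eq (t.2.1 ++ t.2.2) s) f.

(** The coefficient of x_1 ... x_n m once the x_i are made to commute and the
    monomials with a letter to the right of m are discarded. In A(C) a
    product ending in a second coordinate m behaves in exactly this way, so
    lead f = 0 for every multilinear identity f of A(C). *)
Definition lead f : F := \sum_(t <- f | t.2.2 == [::]) t.1.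

(** ldel (rdel) keeps the monomials with the letter i to the left (right) of m
    and deletes i from them, which amounts to putting x_i = 1. *)
Definition ldel i f : seq mterm :=
  [seq (t.1, (rem i t.2.1, t.2.2)) | t <- f & i \in t.2.1].

Definition rdel i f : seq mterm :=
  [seq (t.1, (t.2.1, rem i t.2.2)) | t <- f & i \notin t.2.1].

Lemma multilinear_ldel i s f : multilinear (i :: s) f -> multilinear s (ldel i f).
Proof.
move=> /allP ml; apply/allP => _ /mapP[[c [u v]] + ->] /=.
rewrite mem_filter /= => /andP[iu /ml /= h].
rewrite -(perm_cons i); apply: perm_trans h.
by rewrite -cat_cons perm_cat2r perm_sym perm_to_rem.
Qed.

Lemma multilinear_right i s u v :
  perm_eq (u ++ v) (i :: s) -> i \notin u -> i \in v.
Proof.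
by move=> /perm_mem/(_ i); rewrite mem_cat mem_head => /orP[->|->].
Qed.

Lemma lead_ldel i s f : multilinear (i :: s) f -> lead (ldel i f) = lead f.
Proof.
move=> /allP ml; rewrite /lead big_map big_filter_cond big_seq_cond [RHS]big_seq_cond.
apply: eq_bigl => -[c [u v]] /=; case: (boolP (_ \in f)) => //= /ml /= h.
case: (boolP (i \in u)) => //= iu; have := multilinear_right h iu.
by case: v {h}.
Qed.

Section Evaluation.
Variable A : nualgType F.
Implicit Types (x : nat -> A) (m z X : A).

Fixpoint leftact x u m : A := if u is i :: u' then x i ** leftact x u' m else m.

Fixpoint rightact x m v : A :=
  if v is i :: v' then rightact x (m ** x i) v' else m.

Definition mterm_eval x m (t : mterm) : A := leftact x t.2.1 (rightact x m t.2.2).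

Definition meval x m f : A := \sum_(t <- f) t.1 *: mterm_eval x m t.

Definition kills f (M : set A) : Prop := forall x m, M m -> meval x m f = 0.

Definition subst x i X : nat -> A := fun j => if j == i then X else x j.

Lemma leftact_cat x u u' m : leftact x (u ++ u') m = leftact x u (leftact x u' m).
Proof. by elim: u => //= i u ->. Qed.

Lemma leftactM x u a m : leftact x u (a ** m) = leftact x u a ** m.
Proof. by elim: u => //= i u ->; rewrite nmulA. Qed.

Lemma leftactB x u a b : leftact x u (a - b) = leftact x u a - leftact x u b.
Proof. by elim: u => //= i u ->; rewrite nmulBr. Qed.

Lemma leftactD x u a b : leftact x u (a + b) = leftact x u a + leftact x u b.
Proof. by elim: u => //= i u ->; rewrite nmulDr. Qed.

Lemma leftact0 x u : leftact x u 0 = 0.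
Proof. by elim: u => //= i u ->; rewrite nmul0r. Qed.

Lemma rightact_cat x v v' m : rightact x m (v ++ v') = rightact x (rightact x m v) v'.
Proof. by elim: v m => //= i v IH m. Qed.

Lemma rightactMl x v a m : rightact x (a ** m) v = a ** rightact x m v.
Proof. by elim: v m => //= i v IH m; rewrite -nmulA IH. Qed.

Lemma rightact0 x v : rightact x 0 v = 0.
Proof. by elim: v => //= i v; rewrite nmul0l. Qed.

Lemma leftact_mem (M : set A) x u m : is_ideal M -> M m -> M (leftact x u m).
Proof. by move=> idM Mm; elim: u => //= i u IH; apply: ideal_mull. Qed.

Lemma rightact_mem (M : set A) x v m : is_ideal M -> M m -> M (rightact x m v).
Proof. by move=> idM; elim: v m => //= i v IH m Mm; apply: IH; apply: ideal_mulr. Qed.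

Lemma mterm_eval_mem (M : set A) x m t : is_ideal M -> M m -> M (mterm_eval x m t).
Proof. by move=> idM Mm; apply: (leftact_mem _ _ idM); apply: rightact_mem. Qed.

Lemma meval_mem (M : set A) x m f : is_ideal M -> M m -> M (meval x m f).
Proof.
move=> idM Mm; apply: ideal_sum => // t _; apply: (idealZ idM).
exact: mterm_eval_mem.
Qed.

Lemma leftact_subst x i X u m : i \notin u -> leftact (subst x i X) u m = leftact x u m.
Proof.
elim: u => //= j u IH; rewrite inE negb_or eq_sym => /andP[ij /IH ->].
by rewrite /subst (negPf ij).
Qed.

Lemma rightact_subst x i X v m :
  i \notin v -> rightact (subst x i X) m v = rightact x m v.
Proof.
elim: v m => //= j v IH m; rewrite inE negb_or eq_sym => /andP[ij /IH ->].
by rewrite /subst (negPf ij).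
Qed.

Lemma substE x i X : subst x i X i = X.
Proof. by rewrite /subst eqxx. Qed.

Lemma meval_hom (h : A -> A) x m f : is_nuhom h ->
  h (meval x m f) = meval (h \o x) (h m) f.
Proof.
move=> hh; rewrite (nuhom_sum hh); apply: eq_bigr => -[c [u v]] _ /=.
rewrite (nuhomZ hh); congr (_ *: _); rewrite /mterm_eval /=.
have hr w a : h (rightact x a w) = rightact (h \o x) (h a) w.
  by elim: w a => //= j w IH a; rewrite IH (nuhomM hh).
by elim: u => [|j u /= <-]; rewrite /= ?hr ?(nuhomM hh).
Qed.

Lemma meval_cons x m t f : meval x m (t :: f) = t.1 *: mterm_eval x m t + meval x m f.
Proof. by rewrite /meval big_cons. Qed.

Lemma rem_split i u : uniq u -> i \in u ->
  exists u1 u2, [/\ u = u1 ++ i :: u2, rem i u = u1 ++ u2, i \notin u1 & i \notin u2].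
Proof.
move=> + iu; case/splitPr: iu => u1 u2.
rewrite cat_uniq /= negb_or => /and3P[_ /andP[iu1 _] /andP[iu2 _]].
exists u1, u2; split=> //; rewrite remE index_cat (negPf iu1) /= eqxx addn0.
by rewrite take_size_cat // drop_cat ltnNge leqnSn /= subSnn /= drop0.
Qed.
End Evaluation.
End Terms.

(** * Elements acting centrally on an ideal *)

Section Central.
Variables (F : fieldType) (A : nualgType F) (M : set A).
Implicit Types (x : nat -> A) (m z r X : A) (f : seq (mterm F)).
Hypothesis idM : is_ideal M.

(** z commutes with A up to the annihilator of M; for M killed by W_(n+1) this
    holds for the values of W_n. *)
Definition central_on z : Prop :=
  forall r m, M m -> ncomm z r ** m = 0 /\ m ** ncomm z r = 0.

Lemma central_mull z r m : central_on z -> M m -> r ** (z ** m) = z ** (r ** m).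
Proof.
move=> cz Mm; have [+ _] := cz r m Mm; rewrite nmulBl !nmulA.
by move=> /eqP; rewrite subr_eq0 => /eqP.
Qed.

Lemma central_mulr z r m : central_on z -> M m -> m ** z ** r = m ** r ** z.
Proof.
move=> cz Mm; have [_ +] := cz r m Mm; rewrite nmulBr !nmulA.
by move=> /eqP; rewrite subr_eq0 => /eqP.
Qed.

Lemma central_onM z z' : central_on z -> central_on z' -> central_on (z ** z').
Proof.
move=> cz cz' r m Mm; rewrite ncommMl nmulDl [m ** (_ + _)]nmulDr -!nmulA.
rewrite [m ** (z ** _)]nmulA.
have [_ ->] := cz' r (m ** z) (ideal_mulr idM z Mm).
have [-> _] := cz r (z' ** m) (ideal_mull idM z' Mm).
have [-> _] := cz' r m Mm; rewrite nmul0r.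
by rewrite nmulA; have [_ ->] := cz r m Mm; rewrite nmul0l !addr0.
Qed.

Lemma leftact_central z x u m :
  central_on z -> M m -> leftact x u (z ** m) = z ** leftact x u m.
Proof.
move=> cz Mm; elim: u => //= i u ->.
by rewrite (central_mull _ cz) //; apply: leftact_mem.
Qed.

Lemma rightact_central z x v m :
  central_on z -> M m -> rightact x (m ** z) v = rightact x m v ** z.
Proof.
move=> cz; elim: v m => //= i v IH m Mm.
by rewrite (central_mulr _ cz) // IH //; apply: ideal_mulr.
Qed.

(** A central value of x_i can be pulled out of every monomial, on the side of
    m on which it stands. *)
Lemma meval_central x m i s X f :
  uniq (i :: s) -> multilinear (i :: s) f -> central_on X -> M m ->
  meval (subst x i X) m f = X ** meval x m (ldel i f) + meval x m (rdel i f) ** X.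
Proof.
move=> us + cX Mm; elim: f => [_|[c [u v]] f IH /= /andP[/= ht /IH {}IH]].
  by rewrite /meval !big_nil nmul0l nmul0r addr0.
have uuv : uniq (u ++ v) by rewrite (perm_uniq ht).
move: (uuv); rewrite cat_uniq => /and3P[uu /hasPn dj uv].
rewrite meval_cons IH {IH} /ldel /rdel /= /mterm_eval /=.
case: ifP => iu /=; rewrite meval_cons /mterm_eval /=.
  have iv : i \notin v by apply: contraL iu => /dj.
  have [u1 [u2 [-> -> iu1 iu2]]] := rem_split uu iu.
  rewrite !leftact_cat /= substE !leftact_subst // rightact_subst //.
  rewrite leftact_central //; last by apply: (leftact_mem _ _ idM); apply: rightact_mem.
  by rewrite nmulDr -nscalerAr addrA.
have iv := multilinear_right ht (negbT iu).
have [v1 [v2 [-> -> iv1 iv2]]] := rem_split uv iv.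
rewrite !rightact_cat /= substE leftact_subst ?iu // !rightact_subst //.
rewrite rightact_central //; last exact: rightact_mem.
by rewrite leftactM nmulDl -nscalerAl addrCA.
Qed.
End Central.

Lemma meval_nil_letters (F : fieldType) (A : nualgType F) (x : nat -> A) m
  (f : seq (mterm F)) : multilinear [::] f -> meval x m f = lead f *: m.
Proof.
rewrite /meval /lead scaler_suml; elim: f => [|[c [u v]] f IH /=].
  by rewrite !big_nil.
rewrite !big_cons => /andP[/= /perm_nilP + /IH ->].
by case: u v => [|//] [|//] _.
Qed.

Section Reduction.
Variables (F : fieldType) (A : nualgType F).
Implicit Types (x : nat -> A) (m z r : A) (f : seq (mterm F)) (M Z : set A).

Definition hom_closed Z := forall h : A -> A, is_nuhom h -> forall z, Z z -> Z (h z).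

(** Let a and b be the left and right deletions of the letter i. Centrality
    turns f = 0 into z a + b z = 0 at x_i = z, and into z z' a + b z z' = 0 at
    x_i = z z'; eliminating b leaves z [z', a] = 0. Either some value of a is
    nonzero, and then so is the core of this condition, or a is an identity on M
    with one letter less and the same leading coefficient. *)
Lemma mul_ncomm_reduction s f M Z :
  endo_ideal M -> nontrivial M ->
  (forall z, Z z -> central_on M z) ->
  uniq s -> multilinear s f -> lead f != 0 -> kills f M ->
  exists M1, [/\ endo_ideal M1, nontrivial M1, M1 `<=` M &
    forall z z' m, Z z -> Z z' -> M1 m -> z ** ncomm z' m = 0].
Proof.
move=> eM nM cZ; elim: s f => [|i s IH] f us ml lf kf.
  have [m Mm m0] := nM; case: m0.
  have /eqP := kf (fun=> 0) m Mm; rewrite meval_nil_letters // scaler_eq0.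
  by rewrite (negPf lf) => /eqP.
have key x m z z' : M m -> Z z -> Z z' -> z ** ncomm z' (meval x m (ldel i f)) = 0.
  move=> Mm Zz Zz'; have [idM _] := eM.
  set a := meval x m (ldel i f); have Ma : M a by apply: meval_mem.
  set b := meval x m (rdel i f); have Mb : M b by apply: meval_mem.
  have [cz cz'] := (cZ z Zz, cZ z' Zz').
  have := kf (subst x i z) m Mm; rewrite (meval_central idM _ us) // -/a -/b => e.
  have := kf (subst x i (z ** z')) m Mm.
  rewrite (meval_central idM _ us) //; last exact: central_onM.
  rewrite -/a -/b !nmulA => e'.
  rewrite nmulBr; apply/eqP; rewrite subr_eq0 !nmulA; apply/eqP.
  apply: (addIr (b ** z ** z')); rewrite e'.
  by rewrite -nmulDl e nmul0l.
have [kl|] := pselect (kills (ldel i f) M).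
  move: us => /= /andP[_ us]; apply: (IH _ us _ _ kl).
    exact: multilinear_ldel.
  by rewrite (lead_ldel ml).
have [idM hM] := eM.
move=> /existsNP[x /existsNP[m /not_implyP[Mm a0]]].
exists (endo_core M (fun m => forall z z', Z z -> Z z' -> z ** ncomm z' m = 0)).
split; last by move=> z z' a Zz Zz' /endo_coreP; apply.
- apply: endo_core_ideal => //.
  + by move=> z z' _ _; rewrite ncomm0r nmul0r.
  + by move=> a b ha hb z z' Zz Zz'; rewrite ncommDr nmulDr ha // hb // addr0.
  + by move=> k a ha z z' Zz Zz'; rewrite ncommZr -nscalerAr ha // scaler0.
  + move=> r a Ma ha; split=> z z' Zz Zz'; rewrite ncommMr nmulDr.
      have [-> _] := cZ z' Zz' r a Ma; rewrite nmul0r add0r.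
      rewrite -(central_mull _ (cZ z Zz)); first by rewrite ha // nmul0r.
      by rewrite ncommC; apply: idealN => //; apply: ideal_ncomm.
    have [_ ->] := cZ z' Zz' r a Ma; rewrite nmul0r addr0.
    by rewrite nmulA ha // nmul0l.
- exists (meval x m (ldel i f)) => //; split; first exact: meval_mem.
  by move=> h hh z z' Zz Zz'; rewrite (meval_hom _ _ _ hh) key //; apply: hM.
- by move=> a [].
Qed.
End Reduction.

Section Opposites.
Variables (F : fieldType) (A : nualgType F).
Implicit Types (M : set A).

Lemma endo_ideal_opp M : endo_ideal M <-> @endo_ideal F (algOpp A) M.
Proof.
split=> -[[M0 MD MZ MM] hM]; (split; first split=> //).
- by move=> x y Mx; have [] := MM x y Mx.
- by move=> h [lh mh]; apply: hM; split=> // x y; apply: (mh y x).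
- by move=> x y Mx; have [] := MM x y Mx.
- by move=> h [lh mh]; apply: hM; split=> // x y; apply: (mh y x).
Qed.

Lemma ncomm_opp (x y : A) : @ncomm F (algOpp A) x y = - ncomm x y.
Proof. by rewrite -ncommC. Qed.

Lemma central_on_opp M (z : A) : central_on M z -> @central_on F (algOpp A) M z.
Proof.
move=> cz r m Mm; have [zl zr] := cz r m Mm.
rewrite ncomm_opp; split.
  change (@nmul F A m (- ncomm z r) = 0); by rewrite nmulNr zr oppr0.
by change (@nmul F A (- ncomm z r) m = 0); rewrite nmulNl zl oppr0.
Qed.

Lemma lie_valueN n (r : A) : lie_value n r -> lie_value n (- r).
Proof.
case: n => //= n [a [b [va ->]]]; exists a, (- b); split=> //.
by rewrite /ncomm nmulNl nmulNr opprB opprK addrC.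
Qed.

Lemma lie_value_opp n (r : A) : @lie_value F (algOpp A) n r -> lie_value n r.
Proof.
elim: n r => //= n IH r [a [b [/IH va ->]]].
by rewrite ncomm_opp; apply: (@lie_valueN n.+1); apply: lie_valueS.
Qed.
End Opposites.

Lemma lie_nil_opp (F : fieldType) (A : nualgType F) : lie_nil A <-> lie_nil (algOpp A).
Proof.
split=> -[n h]; exists n => r.
  by move=> /lie_value_opp /h.
by move=> vr; apply: h; apply: (@lie_value_opp F (algOpp A)).
Qed.

Section CentralReduction.
Variables (F : fieldType) (A : nualgType F).
Implicit Types (x : nat -> A) (m z r : A) (f g : seq (mterm F)) (M Z : set A).

(** Applied to f and, in the opposite algebra, to g, the previous reduction
    gives z [z', m] = 0 and [z', m] z = 0, hence [z, [z', m]] = 0; so every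
    nonzero [z', m] commutes with Z. *)
Lemma ncomm_reduction s s' f g M Z :
  endo_ideal M -> nontrivial M -> hom_closed Z ->
  (forall z, Z z -> central_on M z) ->
  uniq s -> multilinear s f -> lead f != 0 -> kills f M ->
  uniq s' -> multilinear s' g -> lead g != 0 -> @kills F (algOpp A) g M ->
  exists M1, [/\ endo_ideal M1, nontrivial M1, M1 `<=` M &
    forall z m, Z z -> M1 m -> ncomm z m = 0].
Proof.
move=> eM nM hZ cZ us mlf lf kf us' mlg lg kg.
have [M1 [eM1 nM1 M1M h1]] := mul_ncomm_reduction eM nM cZ us mlf lf kf.
have cZ1 z : Z z -> central_on M1 z by move=> Zz r m /M1M; apply: cZ.
have eM1' : @endo_ideal F (algOpp A) M1 by apply/endo_ideal_opp.
have kg1 : @kills F (algOpp A) g M1 by move=> x m /M1M; apply: kg.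
have cZ1' z : Z z -> @central_on F (algOpp A) M1 z.
  by move=> Zz; apply/central_on_opp/cZ1.
have [M2 [eM2 nM2 M21 h2]] : exists M2 : set A,
    [/\ endo_ideal M2, nontrivial M2, M2 `<=` M1 &
    forall z z' m, Z z -> Z z' -> M2 m -> ncomm z' m ** z = 0].
  have [M2 [/endo_ideal_opp eM2 nM2 M21 h2]] :=
    @mul_ncomm_reduction F (algOpp A) s' g M1 Z eM1' nM1 cZ1' us' mlg lg kg1.
  exists M2; split=> // z z' m Zz Zz' M2m; apply: oppr_inj; rewrite -nmulNl oppr0.
  by have := h2 z z' m Zz Zz' M2m; rewrite ncomm_opp.
have key z z' m : Z z -> Z z' -> M2 m -> ncomm z (ncomm z' m) = 0.
  move=> Zz Zz' M2m; rewrite [ncomm z _]/ncomm h1 //; last exact: M21.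
  by rewrite h2 // subr0.
pose M3 := endo_core M2 (fun m => forall z, Z z -> ncomm z m = 0).
have [idM2 hM2] := eM2.
exists M3; split; last by move=> z m Zz /endo_coreP; apply.
- apply: endo_core_ideal => //.
  + by move=> z _; rewrite ncomm0r.
  + by move=> a b ha hb z Zz; rewrite ncommDr ha // hb // addr0.
  + by move=> k a ha z Zz; rewrite ncommZr ha // scaler0.
  + move=> r a Ma ha; have M1a := M21 _ Ma.
    split=> z Zz; rewrite ncommMr ha //; have [zl zr] := cZ1 z Zz r a M1a.
      by rewrite zl nmul0r addr0.
    by rewrite zr nmul0l addr0.
- have [hc|] := pselect (forall z m, Z z -> M2 m -> ncomm z m = 0).
    have [m M2m m0] := nM2; exists m => //; split=> // h hh z Zz.
    by apply: hc => //; apply: hM2.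
  move=> /existsNP[z /existsNP[m /not_implyP[Zz /not_implyP[M2m m0]]]].
  exists (ncomm z m) => //; split.
    by rewrite ncommC; apply: idealN => //; apply: ideal_ncomm.
  move=> h hh z' Zz'; rewrite (nuhom_ncomm hh).
  by apply: key => //; [apply: hZ | apply: hM2].
- by move=> m [/M21/M1M].
Qed.
End CentralReduction.

(** * Double commutators on an ideal annihilated by W_3 *)

Lemma rightact_word (F : fieldType) (A : nualgType F) (x : nat -> A) v :
  v = [::] \/ exists w, forall m, rightact x m v = m ** w.
Proof.
case: v => [|i v]; [by left | right].
elim: v i => [|j v IH] i; first by exists (x i).
have [w hw] := IH j; exists (x i ** w) => m /=.
by rewrite nmulA -hw.
Qed.

Section DoubleCommutator.
Variables (F : fieldType) (A : nualgType F) (M : set A).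
Implicit Types (x : nat -> A) (a b c m r X : A) (f : seq (mterm F)).
Hypothesis eM : endo_ideal M.
Hypothesis lie3_l : forall a b c m, M m -> ncomm (ncomm a b) c ** m = 0.
Hypothesis lie3_r : forall a b c m, M m -> m ** ncomm (ncomm a b) c = 0.
Hypothesis lie2_comm : forall a b m, M m -> ncomm (ncomm a b) m = 0.

Let idM : is_ideal M := eM.1.

Lemma lie3_l' a b c m : M m -> ncomm a (ncomm b c) ** m = 0.
Proof. by move=> Mm; rewrite ncommC nmulNl lie3_l // oppr0. Qed.

Lemma lie3_r' a b c m : M m -> m ** ncomm a (ncomm b c) = 0.
Proof. by move=> Mm; rewrite ncommC nmulNr lie3_r // oppr0. Qed.

Lemma lie2_swap a b m : M m -> ncomm a b ** m = m ** ncomm a b.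
Proof. by move=> Mm; apply/ncomm_eq/lie2_comm. Qed.

Lemma ncomm_mem a m : M m -> M (ncomm a m).
Proof. by move=> Mm; rewrite ncommC; apply: idealN => //; apply: ideal_ncomm. Qed.

(** Expand [[r, ab], m] = 0, where commutators commute with m and with the
    commutators of m. *)
Lemma lie2_alternate r a b m : M m ->
  ncomm r a ** ncomm b m + ncomm r b ** ncomm a m = 0.
Proof.
move=> Mm; have := lie2_comm r (a ** b) Mm.
rewrite ncommMr ncommDl !ncommMl !lie2_comm // nmul0l nmul0r add0r addr0.
by rewrite -(lie2_swap r b (ncomm_mem a Mm)).
Qed.

(** On M the map m |-> [b, [a, m]] is linear over A: in the Leibniz expansion
    the mixed terms cancel by lie2_alternate. *)
Lemma dcomm_mull a b r m : M m ->
  ncomm b (ncomm a (r ** m)) = r ** ncomm b (ncomm a m).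
Proof.
move=> Mm; rewrite ncommMr ncommDr !ncommMr lie3_l' // add0r addrA.
rewrite [ncomm a r]ncommC [ncomm b r]ncommC !nmulNl -opprD.
by rewrite lie2_alternate // oppr0 add0r.
Qed.

Lemma dcomm_mulr a b r m : M m ->
  ncomm b (ncomm a (m ** r)) = ncomm b (ncomm a m) ** r.
Proof.
move=> Mm; rewrite ncommMr ncommDr !ncommMr lie3_r' // addr0 -addrA.
rewrite -!(lie2_swap _ _ (ncomm_mem _ Mm)).
rewrite [ncomm b r]ncommC [ncomm a r]ncommC !nmulNl -opprD addrC.
by rewrite lie2_alternate // oppr0 add0r.
Qed.

Lemma dcomm_leftact x a b u m : M m ->
  ncomm b (ncomm a (leftact x u m)) = leftact x u (ncomm b (ncomm a m)).
Proof.
move=> Mm; elim: u => //= i u <-; rewrite dcomm_mull //.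
exact: leftact_mem.
Qed.

(** In a monomial p x_i q with x_i on the left of m, the combination is
    p [b, [a, q]] = [b, [a, p q]]; with x_i on the right it is p [b, [a, q]]
    for a factor q in A, which vanishes since W_3 annihilates M; if x_i is the
    last letter, the four terms cancel. *)
Lemma mterm_eval_dcomm x m i s a b t :
  uniq (i :: s) -> perm_eq (t.2.1 ++ t.2.2) (i :: s) -> M m ->
  mterm_eval (subst x i (b ** a)) m t - mterm_eval (subst x i a) m t ** b
    - mterm_eval (subst x i b) m t ** a
    + mterm_eval x m (t.1, (rem i t.2.1, rem i t.2.2)) ** (a ** b)
  = if i \in t.2.1
    then ncomm b (ncomm a (mterm_eval x m (t.1, (rem i t.2.1, t.2.2)))) else 0.
Proof.
case: t => c [u v] us /= ht Mm; rewrite /mterm_eval /=.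
have uuv : uniq (u ++ v) by rewrite (perm_uniq ht).
move: (uuv); rewrite cat_uniq => /and3P[uu /hasPn dj uv].
case: ifP => iu.
  have iv : i \notin v by apply: contraL iu => /dj.
  rewrite (rem_id iv); have [u1 [u2 [-> -> iu1 iu2]]] := rem_split uu iu.
  rewrite !leftact_cat /= !substE !leftact_subst // !rightact_subst //.
  set h := leftact x u2 _.
  have Mh : M h by apply: leftact_mem => //; apply: rightact_mem.
  rewrite dcomm_leftact // ncomm2E -!leftactM -!leftactB -leftactD.
  by rewrite !nmulA.
have iv := multilinear_right ht (negbT iu).
rewrite (rem_id (negbT iu)); have [v1 [v2 [-> -> iv1 iv2]]] := rem_split uv iv.
rewrite !rightact_cat /= !substE !leftact_subst ?iu // !rightact_subst //.
set n := rightact x m v1; have Mn : M n by apply: rightact_mem.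
rewrite -!leftactM -!leftactB -leftactD.
suff -> : rightact x (n ** (b ** a)) v2 - rightact x (n ** a) v2 ** b
    - rightact x (n ** b) v2 ** a + rightact x n v2 ** (a ** b) = 0.
  by rewrite leftact0.
have [->|[w hw]] := rightact_word x v2; rewrite /= ?hw.
  by rewrite !nmulA addrAC subrK subrr.
by have := lie3_r' b a w Mn; rewrite ncomm2E nmulDr !nmulBr !nmulA.
Qed.

Lemma ncomm_sumr I (r : seq I) (P : pred I) (f : I -> A) a :
  ncomm a (\sum_(i <- r | P i) f i) = \sum_(i <- r | P i) ncomm a (f i).
Proof. exact: (big_morph _ (ncommDr a) (ncomm0r a)). Qed.

Lemma meval_dcomm x m i s a b f :
  uniq (i :: s) -> multilinear (i :: s) f -> M m ->
  meval (subst x i (b ** a)) m f - meval (subst x i a) m f ** b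
    - meval (subst x i b) m f ** a
    + (meval x m (ldel i f) + meval x m (rdel i f)) ** (a ** b)
  = ncomm b (ncomm a (meval x m (ldel i f))).
Proof.
move=> us ml Mm.
have -> : meval x m (ldel i f) + meval x m (rdel i f)
    = \sum_(t <- f) t.1 *: mterm_eval x m (t.1, (rem i t.2.1, rem i t.2.2)).
  rewrite /meval !big_map !big_filter /= [RHS](bigID (fun t => i \in t.2.1)) /=.
  congr (_ + _); rewrite big_seq_cond [RHS]big_seq_cond;
    apply: eq_bigr => -[c [u v]] /= /andP[/(allP ml) /= ht iu].
    have : uniq (u ++ v) by rewrite (perm_uniq ht).
    rewrite cat_uniq => /and3P[_ /hasPn dj _]; rewrite [rem i v]rem_id //.
    by apply: contraL iu => /dj.
  by rewrite [rem i u]rem_id.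
rewrite /meval big_map big_filter !ncomm_sumr !nmul_suml -!sumrB -big_split /=.
rewrite [RHS]big_mkcond /= big_seq [RHS]big_seq; apply: eq_bigr => t /(allP ml) ht.
rewrite -!nscalerAl -!scalerBr -scalerDr (mterm_eval_dcomm _ _ _ us ht) //.
by case: ifP => _; rewrite ?scaler0 ?ncommZr.
Qed.

(** Let c be f at x_i = 1 and let a be its left deletion of i. Putting
    x_i = [y, z] gives [y, z] c = 0, because commutators are central on M.
    If some value of c is nonzero, so is the core of this condition.
    Otherwise meval_dcomm says that [z, [y, a]] = 0, and either some value of a
    is nonzero or a is an identity with one letter less. *)
Lemma dcomm_reduction s f :
  nontrivial M -> uniq s -> multilinear s f -> lead f != 0 -> kills f M ->
  exists M1, [/\ endo_ideal M1, nontrivial M1, M1 `<=` M &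
    (forall a b m, M1 m -> ncomm b (ncomm a m) = 0) \/
    (forall a b m, M1 m -> ncomm a b ** m = 0)].
Proof.
move=> nM; elim: s f => [|i s IH] f us ml lf kf.
  have [m Mm m0] := nM; case: m0.
  have /eqP := kf (fun=> 0) m Mm; rewrite meval_nil_letters // scaler_eq0.
  by rewrite (negPf lf) => /eqP.
have hM := eM.2.
have [kb|] := pselect (forall x m, M m ->
    meval x m (ldel i f) + meval x m (rdel i f) = 0).
  have key x m a b : M m -> ncomm b (ncomm a (meval x m (ldel i f))) = 0.
    move=> Mm; rewrite -(meval_dcomm _ _ _ us ml Mm) kb // !kf // !nmul0l.
    by rewrite !subr0 addr0.
  have [kl|] := pselect (kills (ldel i f) M).
    move: us => /= /andP[_ us]; apply: (IH _ us _ _ kl).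
      exact: multilinear_ldel.
    by rewrite (lead_ldel ml).
  move=> /existsNP[x /existsNP[m /not_implyP[Mm a0]]].
  exists (endo_core M (fun m => forall a b, ncomm b (ncomm a m) = 0)); split.
  - apply: endo_core_ideal => //.
    + by move=> a b; rewrite !ncomm0r.
    + by move=> n n' hn hn' a b; rewrite (ncommDr a) (ncommDr b) hn hn' addr0.
    + by move=> k n hn a b; rewrite !ncommZr hn scaler0.
    + move=> r n Mn hn; split=> a b; first by rewrite dcomm_mull // hn nmul0r.
      by rewrite dcomm_mulr // hn nmul0l.
  - exists (meval x m (ldel i f)) => //; split; first exact: meval_mem.
    by move=> h hh a b; rewrite (meval_hom _ _ _ hh) key //; apply: hM.
  - by move=> n [].
  - by left=> a b n /endo_coreP.
move=> /existsNP[x /existsNP[m /not_implyP[Mm b0]]].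
set n := _ + _ in b0.
have key y m' a b : M m' ->
    ncomm a b ** (meval y m' (ldel i f) + meval y m' (rdel i f)) = 0.
  move=> Mm'; have := kf (subst y i (ncomm a b)) m' Mm'.
  rewrite (meval_central idM _ us) //; last first.
    by move=> r k Mk; rewrite lie3_l // lie3_r.
  by rewrite -lie2_swap ?nmulDr //; apply: meval_mem.
exists (endo_core M (fun m => forall a b, ncomm a b ** m = 0)); split.
- apply: endo_core_ideal => //.
  + by move=> a b; rewrite nmul0r.
  + by move=> k k' hk hk' a b; rewrite nmulDr hk hk' addr0.
  + by move=> c k hk a b; rewrite -nscalerAr hk scaler0.
  + move=> r k Mk hk; split=> a b; last by rewrite nmulA hk nmul0l.
    rewrite -(@central_mull _ _ M) // ?hk ?nmul0r // => r' k' Mk'.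
    by rewrite lie3_l // lie3_r.
- exists n => //; split; first by apply: idealD => //; apply: meval_mem.
  move=> h hh a b; rewrite /n (nuhomD hh) !(meval_hom _ _ _ hh) key //.
  exact: hM.
- by move=> k [].
- by right=> a b k /endo_coreP.
Qed.
End DoubleCommutator.

(** * Non-prime algebras: descent on the Lie class of the annihilator *)

Section Descent.
Variables (F : fieldType) (A : nualgType F).
Implicit Types (x : nat -> A) (a b c m r : A) (f g : seq (mterm F)) (M : set A).

Definition annihilates (Z M : set A) : Prop :=
  forall z m, Z z -> M m -> z ** m = 0 /\ m ** z = 0.

Definition annihilable n : Prop := exists M,
  [/\ endo_ideal M, nontrivial M & annihilates (lie_value n) M].

Hypothesis lie_absorb : forall M, endo_ideal M -> nontrivial M ->
  exists n, lie_value n `<=` M.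

Lemma dcomm_lie_nil M : endo_ideal M -> nontrivial M ->
  (forall a b m, M m -> ncomm b (ncomm a m) = 0) -> lie_nil A.
Proof.
move=> eM nM hM; have [n Mn] := lie_absorb eM nM; exists n.+2.
move=> _ [_ [b [[c [a [/Mn Mc ->]]] ->]]] /=.
by rewrite ncommC (ncommC c) -(scaleN1r (ncomm a c)) ncommZr hM // scaler0 oppr0.
Qed.

Lemma ncomm_lie_nil M : endo_ideal M -> nontrivial M ->
  (forall a m, M m -> ncomm a m = 0) -> lie_nil A.
Proof.
move=> eM nM hM; apply: (dcomm_lie_nil eM nM) => a b m Mm.
by rewrite (hM a m) // ncomm0r.
Qed.

(** Latyshev's inclusion Id(W_k) Id(W_3) <= Id(W_(k+1)), acting on M. Write
    z = [d, s]. Expanding [[d, st], u] = 0 gives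
    [d, s] [t, u] = - [s, u] [d, t], and [d, t] is a sum of two values of
    W_(k+1) when t is itself a commutator. *)
Lemma lie_value_mul_lie3 n M z a b c m : is_ideal M ->
  annihilates (lie_value n.+2) M -> lie_value n.+1 z -> M m ->
  z ** ncomm (ncomm a b) c ** m = 0.
Proof.
move=> idM ann [d [s [vd ->]]] Mm.
have key t u : ncomm d s ** ncomm t u ** m + ncomm s u ** ncomm d t ** m = 0.
  have annl k r : lie_value n.+2 r -> M k -> r ** k = 0.
    by move=> vr Mk; have [] := ann r k vr Mk.
  have := annl m _ (lie_valueS u (lie_valueS (s ** t) vd)) Mm.
  rewrite ncommMr ncommDl !ncommMl.
  have D4 p q r v : (p + q + (r + v)) ** m = p ** m + q ** m + (r ** m + v ** m).
    by rewrite !nmulDl.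
  rewrite D4 -!nmulA.
  rewrite (annl (t ** m) (ncomm (ncomm d s) u)); last first.
  - exact: ideal_mull.
  - by do 2!apply: lie_valueS.
  rewrite (annl m (ncomm (ncomm d t) u)) //; last by do 2!apply: lie_valueS.
  rewrite nmul0r addr0 add0r !nmulA; apply.
have := key (ncomm a b) c; rewrite -[ncomm s c ** _ ** m]nmulA.
suff -> : ncomm d (ncomm a b) ** m = 0 by rewrite nmul0r addr0.
rewrite ncomm_jacobi nmulBl.
have [|-> _ ] := ann (ncomm (ncomm d a) b) m _ Mm; first by do 2!apply: lie_valueS.
have [|-> _ ] := ann (ncomm (ncomm d b) a) m _ Mm; first by do 2!apply: lie_valueS.
by rewrite subrr.
Qed.

Variables (s s' : seq nat) (f g : seq (mterm F)).
Hypothesis us : uniq s.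
Hypothesis mlf : multilinear s f.
Hypothesis lf : lead f != 0.
Hypothesis kf : kills f (@setT A).
Hypothesis us' : uniq s'.
Hypothesis mlg : multilinear s' g.
Hypothesis lg : lead g != 0.
Hypothesis kg : @kills F (algOpp A) g setT.

(** The values z of W_(n+1) are central on M, so after shrinking M they commute
    with M. For n = 0 this is the end. For n = 1 the double commutator reduction
    applies. For n >= 2 the products z' z annihilate M, as z is a value of
    W_3; so either M is annihilated by the z, or some nonzero z m is. *)
Lemma annihilableS n : annihilable n.+1 -> annihilable n \/ lie_nil A.
Proof.
move=> [M [eM nM ann]].
have hZ : hom_closed (@lie_value F A n) by move=> h hh z; apply: lie_value_hom.
have cZ z : lie_value n z -> central_on M z.
  by move=> vz r m Mm; apply: ann => //; apply: lie_valueS.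
have [||M1 [eM1 nM1 M1M comm1]] :=
  ncomm_reduction eM nM hZ cZ us mlf lf _ us' mlg lg _.
- by move=> x m _; apply: kf.
- by move=> x m _; apply: kg.
have {M1M} ann1 : annihilates (lie_value n.+1) M1.
  by move=> z m vz /M1M; apply: ann.
case: n => [|[|n]] in hZ cZ comm1 ann1 ann *.
- by right; apply: (ncomm_lie_nil eM1 nM1) => a m; apply: comm1.
- have [||||M2 [eM2 nM2 M21]] := dcomm_reduction eM1 _ _ _ nM1 us mlf lf _.
  + by move=> a b c m Mm; have [] := ann1 (ncomm (ncomm a b) c) m _ Mm;
      first by do 2!apply: lie_valueS.
  + by move=> a b c m Mm; have [] := ann1 (ncomm (ncomm a b) c) m _ Mm;
      first by do 2!apply: lie_valueS.
  + by move=> a b m Mm; apply: comm1 => //; apply: lie_valueS.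
  + by move=> x m _; apply: kf.
  move=> [h|h]; first by right; apply: (dcomm_lie_nil eM2 nM2).
  left; exists M2; split=> // _ m [a [b [_ ->]]] M2m; split; first exact: h.
  have e : ncomm (ncomm a b) m = 0.
    by apply: comm1; [apply: lie_valueS | apply: M21].
  by rewrite -(ncomm_eq e) h.
have [idM1 hM1] := eM1.
left; exists (endo_core M1 (fun m => forall z, lie_value n.+2 z -> z ** m = 0)).
split.
- apply: endo_core_ideal => //.
  + by move=> z _; rewrite nmul0r.
  + by move=> a b ha hb z vz; rewrite nmulDr ha // hb // addr0.
  + by move=> k a ha z vz; rewrite -nscalerAr ha // scaler0.
  + move=> r m Mm hm; split=> z vz; last by rewrite nmulA hm // nmul0l.
    rewrite -(@central_mull _ _ M1) ?hm ?nmul0r //.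
    by move=> r' m' Mm'; apply: ann1 => //; apply: lie_valueS.
- have [hc|] := pselect (forall z m, lie_value n.+2 z -> M1 m -> z ** m = 0).
    have [m Mm m0] := nM1; exists m => //; split=> // h hh z vz.
    by apply: hc => //; apply: hM1.
  move=> /existsNP[z /existsNP[m /not_implyP[vz /not_implyP[Mm m0]]]].
  exists (z ** m) => //; split; first exact: ideal_mull.
  move=> h hh z' vz'; rewrite (nuhomM hh) nmulA.
  have [_ [c [[a [b [_ ->]]] ->]]] := lie_value_hom hh vz.
  apply: (lie_value_mul_lie3 _ _ _ idM1 ann1 vz'); exact: hM1.
- move=> z m vz m1; have zm := endo_coreP m1 z vz; split=> //.
  by rewrite -zm; apply/esym/ncomm_eq/comm1 => //; case: m1.
Qed.

Lemma annihilable_lie_nil n : annihilable n -> lie_nil A.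
Proof.
elim: n => [|n IH]; last by case/annihilableS.
move=> [M [eM nM ann]]; apply: (ncomm_lie_nil eM nM) => a m Mm.
by have [am ma] := ann a m I Mm; rewrite /ncomm am ma subrr.
Qed.

(** Both ideals contain the values of some W_k, which therefore annihilate
    their intersection on both sides. *)
Lemma nonprime_lie_nil M N :
  endo_ideal M -> nontrivial M -> endo_ideal N -> nontrivial N ->
  (forall m n, M m -> N n -> m ** n = 0) -> lie_nil A.
Proof.
move=> eM nM eN nN MN0.
have [j Mj] := lie_absorb eM nM; have [k Nk] := lie_absorb eN nN.
have [//|/forallNP h] := pselect (lie_nil A).
have vM : lie_value (j + k) `<=` M by apply: ideal_lie_value Mj; case: eM.
have vN : lie_value (j + k) `<=` N.
  by rewrite addnC; apply: ideal_lie_value Nk; case: eN.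
apply: (@annihilable_lie_nil (j + k)); exists (M `&` N); split.
- have [[idM hM] [idN hN]] := (eM, eN); split; first split.
  + by split; [case: idM|case: idN].
  + by move=> a b [? ?] [? ?]; split; apply: idealD.
  + by move=> c a [? ?]; split; apply: idealZ.
  + by move=> a b [? ?]; split; split; by [apply: ideal_mulr|apply: ideal_mull].
  + by move=> e he a [? ?]; split; [apply: hM|apply: hN].
- have /existsNP[r /not_implyP[vr r0]] := h (j + k)%N.
  by exists r; [split; [apply: vM|apply: vN] | exact: r0].
- by move=> z m vz [Mm Nm]; split; apply: MN0 => //; [apply: vM|apply: vN].
Qed.
End Descent.

(** * Algebras with the identity [x, y] z = 0 *)

Section LeftCommutative.
Variables (F : fieldType) (A : nualgType F).
Implicit Types (x : nat -> A) (a b c m r : A) (f : seq (mterm F)) (l : seq A).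
Hypothesis comm_l : forall a b c, ncomm a b ** c = 0.

Lemma nmul_leftCA a b c : a ** (b ** c) = b ** (a ** c).
Proof.
by have := comm_l a b c; rewrite nmulBl !nmulA => /eqP; rewrite subr_eq0 => /eqP.
Qed.

Lemma leftact_perm x m u v : perm_eq u v -> leftact x u m = leftact x v m.
Proof.
have mv i w c : x i ** leftact x w c = leftact x w (x i ** c).
  by elim: w => //= j w IH; rewrite nmul_leftCA IH.
move=> puv; apply/esym.
apply: (@catCA_perm_ind _ (fun w => leftact x w m = leftact x u m)) puv erefl
  => s1 s2 s3 <-.
rewrite !leftact_cat; elim: s1 => //= i s1 <-.
by rewrite -mv.
Qed.

Lemma lie_valueE n r : lie_value n.+1 r ->
  exists l a b, size l = n /\ r = foldr (fun c m => c ** m) (ncomm a b) l.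
Proof.
elim: n r => [|n IH] r; first by move=> [a [b [_ ->]]]; exists [::], a, b.
move=> [_ [c [/IH[l [a [b [sl ->]]]] ->]]]; exists (- c :: l), a, b.
split; first by rewrite /= sl.
rewrite /= nmulNl [LHS]/ncomm.
suff -> : foldr (fun c m => c ** m) (ncomm a b) l ** c = 0 by rewrite sub0r.
by elim: {sl} l => [|d l IHl] /=; rewrite ?comm_l // -nmulA IHl nmul0r.
Qed.

(** At m = [a, b] only the monomials x_u m survive, and the letters of u may be
    permuted; so x_1 ... x_n [a, b] = 0, and this is a left-normed commutator up
    to signs absorbed by the x_i. *)
Lemma kills_lie_nil s f : uniq s -> multilinear s f -> lead f != 0 ->
  kills f (@setT A) -> lie_nil A.
Proof.
move=> us ml lf kf; exists (size s).+1 => r /lie_valueE[l [a [b [sl ->]]]] /=.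
pose x i := nth 0 l (index i s).
have -> : l = map x s.
  apply: (@eq_from_nth _ 0); rewrite ?size_map // sl => i il.
  by rewrite (nth_map 0%N) // /x index_uniq.
have -> : foldr (fun c m => c ** m) (ncomm a b) (map x s) = leftact x s (ncomm a b).
  by elim: (s) => //= i s' ->.
have /eqP := kf x (ncomm a b) I.
suff -> : meval x (ncomm a b) f = lead f *: leftact x s (ncomm a b).
  by rewrite scaler_eq0 (negPf lf) => /eqP.
rewrite /meval /lead scaler_suml [RHS]big_mkcond /= big_seq [RHS]big_seq.
apply: eq_bigr => -[c [u v]] /(allP ml) /=; rewrite /mterm_eval /=.
case: v => [|i v] /=; first by rewrite cats0 => /(leftact_perm _ _) ->.
move=> _; rewrite comm_l.
by rewrite rightact0 leftact0 scaler0.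
Qed.
End LeftCommutative.

(** * Evaluation of polynomials *)

Section WordEval.
Variables (F : fieldType) (A : nualgType F).
Implicit Types (a : nat -> A) (u v w : seq nat).

Lemma word_evalE a i w : word_eval a (i :: w) = rightact a (a i) w.
Proof. by rewrite /=; elim: w (a i) => //= j w IH m; rewrite IH. Qed.

Lemma word_eval_cat a u v : u != [::] -> v != [::] ->
  word_eval a (u ++ v) = word_eval a u ** word_eval a v.
Proof.
case: u => // i u _; case: v => // j v _.
rewrite cat_cons !word_evalE rightact_cat /=.
by rewrite rightactMl.
Qed.

Lemma word_eval_rcons a w i : w != [::] ->
  word_eval a (rcons w i) = word_eval a w ** a i.
Proof. by move=> w0; rewrite -cats1 word_eval_cat. Qed.

Lemma word_eval_split a u i v :
  word_eval a (u ++ i :: v) = leftact a u (rightact a (a i) v).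
Proof.
elim: u => [|j u IH]; first by rewrite word_evalE.
by rewrite cat_cons -cat1s word_eval_cat ?IH //; case: u {IH}.
Qed.

End WordEval.

Lemma word_eval_hom (F : fieldType) (A B : nualgType F) (h : A -> B) a w :
  is_nuhom h -> h (word_eval a w) = word_eval (h \o a) w.
Proof.
move=> hh; case: w => [|i w]; first exact: nuhom0.
rewrite !word_evalE /=; elim: w (a i) => //= j w IH m.
by rewrite IH (nuhomM hh).
Qed.

Section LinearExtension.
Variables (F : fieldType) (V : lmodType F).
Local Notation mon := {fmonom nat}.

Definition lin_eval (e : mon -> V) (g : {malg F[mon]}) : V :=
  \sum_(w <- msupp g) mcoeff w g *: e w.

Lemma lin_evalEw (e : mon -> V) (d : {fset mon}) (g : {malg F[mon]}) :
  (msupp g `<=` d)%fset -> lin_eval e g = \sum_(w <- d) mcoeff w g *: e w.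
Proof.
move=> sd; apply: big_fset_incl => // w _ /mcoeff_outdom ->.
by rewrite scale0r.
Qed.

Lemma lin_evalP (e : mon -> V) : linear (lin_eval e).
Proof.
move=> k g g'; have s1 := fsubset_trans (msuppZ_le k g) (fsubsetUl _ (msupp g')).
rewrite (@lin_evalEw e (msupp g `|` msupp g')%fset (k *: g + g')); last first.
  by apply: fsubset_trans (msuppD_le _ _) _; rewrite fsubUset s1 fsubsetUr.
rewrite (lin_evalEw _ (fsubsetUl _ (msupp g'))) (lin_evalEw _ (fsubsetUr (msupp g) _)).
rewrite scaler_sumr -big_split /=; apply: eq_bigr => w _.
by rewrite mcoeffD mcoeffZ scalerDl scalerA.
Qed.

Lemma lin_evalD e : {morph lin_eval e : g g' / g + g'}.
Proof. by move=> g g'; rewrite -[g in LHS]scale1r lin_evalP scale1r. Qed.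

Lemma lin_eval0 e : lin_eval e 0 = 0.
Proof. by rewrite /lin_eval msupp0 big_seq_fset0. Qed.

Lemma lin_evalU e c w : lin_eval e << c *g w >> = c *: e w.
Proof.
rewrite (lin_evalEw e (@msuppU_le _ _ w c)) big_seq_fset1.
by rewrite mcoeffUU.
Qed.

Lemma lin_eval_sum e I (r : seq I) (P : pred I) (g : I -> {malg F[mon]}) :
  lin_eval e (\sum_(i <- r | P i) g i) = \sum_(i <- r | P i) lin_eval e (g i).
Proof. exact: (big_morph _ (lin_evalD e) (lin_eval0 e)). Qed.

End LinearExtension.

Section Evaluation.
Variables (F : fieldType) (A : nualgType F).
Implicit Types (a : nat -> A) (f g : fpoly F).
Local Notation mon := {fmonom nat}.

Lemma fpoly_supp f (w : mon) : w \in msupp (fpoly_val f) -> (w : seq nat) != [::].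
Proof.
rewrite -mcoeff_neq0; apply: contraNneq => w0.
have -> : w = mone by apply/eqP; rewrite fmP fm1 w0.
exact: fpolyP.
Qed.

Lemma feval_hom a : is_nuhom (feval a).
Proof.
split; first by move=> k f g; exact: lin_evalP.
move=> f g; change (lin_eval (word_eval a) (fpoly_val f * fpoly_val g) =
  feval a f ** feval a g).
rewrite malgME lin_eval_sum /feval nmul_suml big_seq [RHS]big_seq.
apply: eq_bigr => u /fpoly_supp u0; rewrite lin_eval_sum nmul_sumr.
rewrite big_seq [RHS]big_seq; apply: eq_bigr => v /fpoly_supp v0.
by rewrite lin_evalU fmM word_eval_cat // -nscalerAl -nscalerAr scalerA.
Qed.

Lemma feval_var a i : feval a (fvar F i) = a i.
Proof.
rewrite [feval a _](_ : _ = lin_eval (word_eval a) << fmu i >>) //.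
by rewrite lin_evalU scale1r fmuE.
Qed.
End Evaluation.

Lemma val_word (F : fieldType) w : w != [::] ->
  fpoly_val (word_eval (fvar F) w) = << FMonom w >>.
Proof.
elim/last_ind: w => // w i IH _; have [->|w0] := eqVneq w [::].
  by rewrite /= fmuE.
rewrite word_eval_rcons //= IH // malgM_def fgmulUU mulr1.
by rewrite -cats1; congr << _ >>; apply/eqP; rewrite fmP fmM fmuE.
Qed.

Lemma feval_fvar (F : fieldType) (f : fpoly F) : feval (fvar F) f = f.
Proof.
apply: val_inj; rewrite [LHS](_ : _ = \sum_(w <- msupp (fpoly_val f))
  fpoly_val (mcoeff w (fpoly_val f) *: word_eval (fvar F) w)); last first.
  exact: (big_morph (@fpoly_val F)).
rewrite [RHS]monalgE big_seq [RHS]big_seq; apply: eq_bigr => w /fpoly_supp w0 /=.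
by rewrite val_word // fmK; apply/malgP => v; rewrite mcoeffZ !mcoeffU mulrnAr mulr1.
Qed.

Lemma feval_nuhom (F : fieldType) (A B : nualgType F) (h : A -> B) a (f : fpoly F) :
  is_nuhom h -> h (feval a f) = feval (h \o a) f.
Proof.
move=> hh; rewrite (nuhom_sum hh); apply: eq_bigr => w _.
by rewrite (nuhomZ hh) word_eval_hom.
Qed.

Lemma nuhom_feval (F : fieldType) (A : nualgType F) (h : fpoly F -> A) f :
  is_nuhom h -> h f = feval (h \o @fvar F) f.
Proof. by move=> hh; rewrite -[f in LHS]feval_fvar feval_nuhom. Qed.

(** * T-ideals, relatively free algebras and varieties *)

Section LieW.
Variables (F : fieldType).

Lemma eq_feval (A : nualgType F) (a b : nat -> A) f : a =1 b -> feval a f = feval b f.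
Proof. by move=> /funext ->. Qed.

Lemma feval_lieW (A : nualgType F) (a : nat -> A) n :
  lie_value n.+1 (feval a (lieW F n)).
Proof.
elim: n => [|n IH]; rewrite (nuhom_ncomm (feval_hom a)); last exact: lie_valueS.
exact: (@lie_valueS _ _ 0).
Qed.

Lemma lie_value_lieW (A : nualgType F) n (r : A) :
  lie_value n.+1 r -> exists a, feval a (lieW F n) = r.
Proof.
have ext (a b : nat -> A) k : (forall i, (i < k.+2)%N -> a i = b i) ->
    feval a (lieW F k) = feval b (lieW F k).
  elim: k => [|k IH] ab; rewrite !(nuhom_ncomm (feval_hom _)) !feval_var ?ab //.
  by rewrite IH // => i ik; apply: ab; apply: ltnW.
elim: n r => [|n IH] r [b [c [vb ->]]].
  exists (fun i => if i is 0 then b else c).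
  by rewrite (nuhom_ncomm (feval_hom _)) !feval_var.
have [a ab] := IH b vb; exists (fun i => if i == n.+2 then c else a i).
rewrite (nuhom_ncomm (feval_hom _)) feval_var eqxx -ab; congr ncomm.
by apply: ext => i; case: eqP => // -> ; rewrite ltnn.
Qed.
End LieW.

Section RelativelyFree.
Variables (F : fieldType) (J : set (fpoly F)).
Hypothesis TJ : is_Tideal J.
Local Notation R := (quot_alg J).

Lemma quot_proj_hom : is_nuhom (quot_proj J : fpoly F -> R).
Proof.
split=> [k x y|x y]; last exact: quot_projM.
by rewrite quot_projD quot_projZ.
Qed.

Lemma quot_proj_eq0 f : quot_proj J f = 0 <-> J f.
Proof.
rewrite -(nuhom0 quot_proj_hom) quot_projP subr0; split; last by move=> Jf I _; apply.
by move/(_ J); apply=> //; case: TJ.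
Qed.

Lemma feval_quot (a : nat -> R) f :
  feval a f = quot_proj J (feval (fun i => quot_repr (a i)) f).
Proof.
rewrite (feval_nuhom _ _ quot_proj_hom).
by apply: eq_feval => i /=; rewrite quot_proj_repr.
Qed.

(** F<X>/J is the relatively free algebra of the identities J. *)
Lemma quot_identity f : identity_of R f <-> J f.
Proof.
split=> [h|Jf a].
  apply/quot_proj_eq0; rewrite -[f]feval_fvar (feval_nuhom _ _ quot_proj_hom).
  exact: h.
by rewrite feval_quot; apply/quot_proj_eq0; apply: TJ.2 => //; apply: feval_hom.
Qed.

Lemma quot_endo_lift (h : R -> R) : is_nuhom h -> exists2 g : fpoly F -> fpoly F,
  is_nuhom g & forall f, quot_proj J (g f) = h (quot_proj J f).
Proof.
move=> hh; exists (feval (fun i => quot_repr (h (quot_proj J (fvar F i))))).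
  exact: feval_hom.
move=> f; rewrite (feval_nuhom _ _ quot_proj_hom).
rewrite -[X in h (quot_proj J X)]feval_fvar (feval_nuhom _ _ quot_proj_hom).
rewrite (feval_nuhom _ _ hh).
by apply: eq_feval => i /=; rewrite quot_proj_repr.
Qed.

Lemma quot_endo_induced (g : fpoly F -> fpoly F) : is_nuhom g ->
  exists2 h : R -> R, is_nuhom h & forall f, quot_proj J (g f) = h (quot_proj J f).
Proof.
move=> hg; have e f : quot_proj J (g f) = quot_proj J (g (quot_repr (quot_proj J f))).
  apply/eqP; rewrite -subr_eq0 -(nuhomB quot_proj_hom) -(nuhomB hg); apply/eqP.
  apply/quot_proj_eq0; apply: TJ.2 => //; apply/quot_proj_eq0.
  by rewrite (nuhomB quot_proj_hom) quot_proj_repr subrr.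
exists (fun r => quot_proj J (g (quot_repr r))) => //; split.
  move=> k; elim/quot_ind => x; elim/quot_ind => y.
  rewrite -(nuhomZ quot_proj_hom) -(nuhomD quot_proj_hom) -!e.
  by rewrite (nuhomD hg) (nuhomZ hg) (nuhomD quot_proj_hom) (nuhomZ quot_proj_hom).
elim/quot_ind => x; elim/quot_ind => y.
by rewrite -(nuhomM quot_proj_hom) -!e (nuhomM hg) (nuhomM quot_proj_hom).
Qed.

Lemma Tideal_preimage (M : set R) : endo_ideal M ->
  is_Tideal [set f | M (quot_proj J f)].
Proof.
move=> [idM hM]; split; first split => /=.
- by rewrite (nuhom0 quot_proj_hom); case: idM.
- by move=> x y Mx My; rewrite quot_projD; apply: idealD.
- by move=> k x Mx; rewrite (nuhomZ quot_proj_hom); apply: idealZ.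
- move=> x y Mx; rewrite !(nuhomM quot_proj_hom).
  by split; [apply: ideal_mulr|apply: ideal_mull].
by move=> g hg f /= Mf; have [h hh ->] := quot_endo_induced hg; apply: hM.
Qed.

Lemma endo_ideal_image (I : set (fpoly F)) : is_Tideal I ->
  endo_ideal [set quot_proj J f | f in I].
Proof.
move=> [idI hI]; split; first split.
- by exists 0; [case: idI | apply: (nuhom0 quot_proj_hom)].
- move=> _ _ [x Ix <-] [y Iy <-]; exists (x + y); first exact: idealD.
  exact: quot_projD.
- move=> k _ [x Ix <-]; exists (k *: x); first exact: idealZ.
  exact: (nuhomZ quot_proj_hom).
- move=> _ y [x Ix <-]; elim/quot_ind: y => y; split.
    by exists (x ** y); [apply: ideal_mulr | apply: quot_projM].
  by exists (y ** x); [apply: ideal_mull | apply: quot_projM].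
move=> h hh _ [x Ix <-]; have [g hg e] := quot_endo_lift hh.
by exists (g x) => //; apply: hI.
Qed.
End RelativelyFree.

Section Varieties.
Variable F : fieldType.
Implicit Types (V W : algclass F) (A B : nualgType F).

Lemma T_of_Tideal V : is_Tideal (T_of V).
Proof.
split; first split.
- by move=> A VA a; rewrite (nuhom0 (feval_hom a)).
- by move=> x y Tx Ty A VA a; rewrite (nuhomD (feval_hom a)) Tx // Ty // addr0.
- by move=> k x Tx A VA a; rewrite (nuhomZ (feval_hom a)) Tx // scaler0.
- move=> x y Tx; split=> A VA a; rewrite (nuhomM (feval_hom a)) Tx //.
    by rewrite nmul0l.
  by rewrite nmul0r.
move=> h hh f Tf A VA a.
by rewrite [LHS](nuhom_feval _ (nuhom_comp hh (feval_hom a))) Tf.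
Qed.

Definition free_alg V : nualgType F := quot_alg (T_of V).

Lemma free_alg_identity V f : identity_of (free_alg V) f <-> T_of V f.
Proof. exact/quot_identity/T_of_Tideal. Qed.

Lemma variety_free_alg V : is_variety V -> V (free_alg V).
Proof.
move=> [S VS]; apply/VS => f Sf; apply/free_alg_identity => A /VS; exact.
Qed.

Lemma lie_nilpotentP V : lie_nilpotent V <-> lie_nil (free_alg V).
Proof.
split=> -[n h].
  exists n.+1 => r /lie_value_lieW[a <-] /=.
  exact: (free_alg_identity V _).2.
exists n; apply/free_alg_identity => a.
by apply: h; apply: (@lie_value_le _ _ n 1); rewrite addn1; apply: feval_lieW.
Qed.

Lemma lie_nilpotent_alg V A : lie_nilpotent V -> V A -> lie_nil A.
Proof.
by move=> [n h] VA; exists n.+1 => r /lie_value_lieW[a <-]; apply: h.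
Qed.

(** The preimage of M in F<X> is a T-ideal larger than T(V), so it defines a
    proper subvariety, and this subvariety is Lie nilpotent. *)
Lemma almost_lie_nilpotent_absorb V : is_variety V -> almost_lie_nilpotent V ->
  forall M, endo_ideal M -> nontrivial M ->
  exists n, @lie_value F (free_alg V) n `<=` M.
Proof.
move=> vV [_ minV] M eM [r Mr r0].
have TV := T_of_Tideal V; have TJ := Tideal_preimage TV eM.
set J := [set f | _] in TJ.
pose W : algclass F := fun A => forall f, J f -> identity_of A f.
have TVJ f : T_of V f -> J f.
  by move=> /(quot_proj_eq0 TV) e; rewrite /J /= e; case: (eM) => -[].
have WJ : W (quot_alg J) by move=> f Jf; apply/quot_identity.
have [|||n Wn] := minV W; first by exists J.
- case: vV => S VS A WA; apply/VS => f Sf; apply/WA/TVJ => B /VS; exact.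
- move=> /(_ _ (variety_free_alg vV)) WR; apply: r0.
  rewrite -(quot_proj_repr r); apply/(quot_proj_eq0 TV)/free_alg_identity/WR.
  by rewrite /J /= quot_proj_repr.
have Jn : J (lieW F n) by apply/(quot_identity TJ); apply: Wn.
exists n.+1 => r' /lie_value_lieW[a <-]; rewrite feval_quot.
by apply: (TJ.2 _ (feval_hom _)).
Qed.

Lemma nonprime_ideals V : ~ prime_variety V -> exists M N : set (free_alg V),
  [/\ endo_ideal M /\ nontrivial M, endo_ideal N /\ nontrivial N &
    forall m n, M m -> N n -> m ** n = 0].
Proof.
have TV := T_of_Tideal V.
move=> /existsNP[I /existsNP[J /not_implyP[TI /not_implyP[TJ /not_implyP[IJ]]]]].
move=> /not_orP[/existsNP[f /not_implyP[If Tf]] /existsNP[g /not_implyP[Jg Tg]]].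
exists [set quot_proj (T_of V) f | f in I], [set quot_proj (T_of V) f | f in J].
split; try split; try exact: endo_ideal_image.
- by exists (quot_proj (T_of V) f); [exists f | move/(quot_proj_eq0 TV)].
- by exists (quot_proj (T_of V) g); [exists g | move/(quot_proj_eq0 TV)].
move=> _ _ [x Ix <-] [y Jy <-]; rewrite -(nuhomM (quot_proj_hom _)).
apply/(quot_proj_eq0 TV)/IJ.
exists [:: (x, y)]; last by rewrite big_seq1.
by move=> q; rewrite inE => /eqP ->.
Qed.
End Varieties.

(** * Multihomogeneous components of identities *)

Section Multidegree.
Variable F : fieldType.
Hypothesis infF : infinite_set [set: F].
Local Notation mon := {fmonom nat}.

Lemma infinite_nonroot (q : {poly F}) : q != 0 -> exists t, q.[t] != 0.
Proof.
move=> q0; have [B _ Bq] := infinite_set_fset (size q) infF.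
have [|/forallNP h] := pselect (exists t, q.[t] != 0); first by [].
have : (size (enum_fset B) < size q)%N.
  apply: max_poly_roots (fset_uniq B) => //; apply/allP => t _; apply/rootP.
  by have /negP := h t; rewrite negbK => /eqP.
by rewrite ltnNge Bq.
Qed.

(** Eliminating the last coefficient from the relations at u and t u leaves a
    relation with coefficients (t^n - t^d) e_d; a suitable t makes all the
    factors nonzero. *)
Lemma vandermonde_vanish (V : lmodType F) n (e : nat -> V) :
  (forall t : F, \sum_(d < n) t ^+ d *: e d = 0) -> forall d, (d < n)%N -> e d = 0.
Proof.
elim: n e => // n IH e h.
have [|t ht] := @infinite_nonroot (\prod_(d < n) ('X^n - 'X^d)).
  rewrite prodf_seq_neq0; apply/allP => d _; rewrite implyTb subr_eq0.
  apply/eqP => /(congr1 (fun q : {poly F} => size q)); rewrite !size_polyXn => -[] e'.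
  by move: (ltn_ord d); rewrite -e' ltnn.
have e0 d : (d < n)%N -> e d = 0.
  move=> dn; have /eqP : (t ^+ n - t ^+ d) *: e d = 0.
    apply: (IH (fun d => (t ^+ n - t ^+ d) *: e d)) dn => u.
    have := h (t * u); have := h u; rewrite !big_ord_recr /= => h1 h2.
    transitivity (t ^+ n *: (\sum_(i < n) u ^+ i *: e i + u ^+ n *: e n)
      - (\sum_(i < n) (t * u) ^+ i *: e i + (t * u) ^+ n *: e n)); last first.
      by rewrite h1 h2 scaler0 subr0.
    rewrite scalerDr opprD addrACA scalerA -exprMn subrr addr0 scaler_sumr -sumrB.
    apply: eq_bigr => i _; rewrite !scalerA -scalerBl exprMn mulrBr.
    by rewrite [_ * u ^+ i]mulrC [t ^+ i * _]mulrC.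
  rewrite scaler_eq0 => /orP[|/eqP //].
  move: ht; rewrite horner_prod prodf_seq_neq0 => /allP/(_ (Ordinal dn)).
  by rewrite mem_index_enum !hornerE => /(_ isT) /= /negPf ->.
move=> d; rewrite ltnS leq_eqVlt => /orP[/eqP ->|]; last exact: e0.
have := h 1; rewrite big_ord_recr /= big1 ?add0r ?expr1n ?scale1r // => i _.
by rewrite e0 ?scaler0.
Qed.

Variable A : nualgType F.
Implicit Types (a : nat -> A) (f : fpoly F) (P : pred (seq nat)).

Definition component P a f : A :=
  \sum_(w <- msupp (fpoly_val f) | P w) mcoeff w (fpoly_val f) *: word_eval a w.

Lemma word_eval_scale a i t w :
  word_eval (fun j => if j == i then t *: a j else a j) w
  = t ^+ count_mem i w *: word_eval a w.
Proof.
elim/last_ind: w => [|w j IH]; first by rewrite scale1r.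
have [->|w0] := eqVneq w [::].
  by rewrite /= addn0; case: eqP => _ /=; rewrite ?expr1 ?scale1r.
rewrite !word_eval_rcons // IH -cats1 count_cat /= addn0 -nscalerAl.
case: eqP => _ /=; last by rewrite addn0.
by rewrite -nscalerAr scalerA addn1 exprSr.
Qed.

Lemma component_count P f i d :
  (forall a, component P a f = 0) ->
  forall a, component (fun w => P w && (count_mem i w == d)) a f = 0.
Proof.
move=> h a.
pose n := (\max_(w <- msupp (fpoly_val f)) count_mem i (w : seq nat)).+1.
have wn (w : mon) : w \in msupp (fpoly_val f) -> (count_mem i (w : seq nat) < n)%N.
  move=> wf; rewrite ltnS.
  exact: (@leq_bigmax_seq _ _ _ (fun w : mon => count_mem i (w : seq nat))).
pose e k := component (fun w => P w && (count_mem i w == k)) a f.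
have [dn|nd] := ltnP d n; last first.
  rewrite /component big_seq_cond big1 // => w /andP[/wn + /andP[_ /eqP wd]].
  by rewrite wd ltnNge nd.
apply: (@vandermonde_vanish _ n e) dn => t.
rewrite -[RHS](h (fun j => if j == i then t *: a j else a j)) /component.
rewrite [RHS]big_seq_cond.
rewrite (partition_big (fun w : mon => inord (count_mem i (w : seq nat)) : 'I_n)
  xpredT) //=.
apply: eq_bigr => k _; rewrite /e /component scaler_sumr big_seq_cond.
apply: eq_big => [w|w /andP[wf /andP[_ /eqP wk]]].
  case: (boolP (w \in _)) => //= /wn wlt; congr (_ && _).
  by rewrite -(inj_eq val_inj) /= inordK.
by rewrite word_eval_scale wk !scalerA mulrC.
Qed.

(** Over an infinite field the multihomogeneous components of an identity are
    identities: they are separated one letter at a time by component_count. *)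
Lemma multilinear_component f s : identity_of A f ->
  forall a, component (fun w => perm_eq w s) a f = 0.
Proof.
move=> idf a.
pose L := s ++ flatten (map (@fmonom_val nat) (enum_fset (msupp (fpoly_val f)))).
have {}idf b :
    component (fun w => all (fun i => count_mem i w == count_mem i s) L) b f = 0.
  elim: L b => [|i L IH] b.
    by rewrite -[RHS](idf b); apply: eq_bigl.
  rewrite -[RHS](component_count i (count_mem i s) IH b).
  by apply: eq_bigl => w /=; rewrite andbC.
rewrite -[RHS](idf a) /component big_seq_cond [RHS]big_seq_cond.
apply: eq_bigl => w; case: (boolP (w \in _)) => //= wf.
apply/idP/allP => [/permP pw i _|h]; first by rewrite pw.
apply/allP => i; rewrite mem_cat => iL; apply: h; rewrite mem_cat.
case/orP: iL => [iw|->//]; apply/orP; right; apply/flattenP.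
by exists (fmonom_val w) => //; apply: map_f.
Qed.
End Multidegree.

(** * The algebra C *)

Lemma ncomm_hom_gens (F : fieldType) (A : nualgType F) (h : fpoly F -> A) y g :
  is_nuhom h -> (forall i, ncomm y (h (fvar F i)) = 0) -> ncomm y (h g) = 0.
Proof.
move=> hh yh; rewrite (nuhom_feval _ hh) ncomm_sumr big1 // => -[[|j w]] _.
  by rewrite ncommZr ncomm0r scaler0.
rewrite ncommZr word_evalE /=.
suff -> : ncomm y (rightact (h \o fvar F) (h (fvar F j)) w) = 0.
  by rewrite scaler0.
elim: w (h _) (yh j) => //= k w IH m ym; apply: IH.
by rewrite ncommMr ym nmul0l add0r yh nmul0r.
Qed.

Section PermCoef.
Variable F : fieldType.
Implicit Types (s t u v w : seq nat) (f g y : fpoly F).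
Local Notation mon := {fmonom nat}.
Local Notation word := (word_eval (fvar F)).

Lemma linear_words (V : lmodType F) (phi : fpoly F -> V) g : linear phi ->
  phi g = \sum_(w <- msupp (fpoly_val g)) mcoeff w (fpoly_val g) *: phi (word w).
Proof.
move=> lphi; rewrite -[g in LHS]feval_fvar.
have p0 : phi 0 = 0.
  by have := lphi (-1) 0 0; rewrite !scaler0 addr0 scaleN1r addNr.
have pD x y : phi (x + y) = phi x + phi y by have := lphi 1 x y; rewrite !scale1r.
have pZ k x : phi (k *: x) = k *: phi x by have := lphi k x 0; rewrite p0 !addr0.
by rewrite /feval (big_morph phi pD p0); apply: eq_bigr => w _; rewrite pZ.
Qed.

(** The coefficient of the commutative monomial with the letters s in the image
    of g in the polynomial ring. *)
Definition perm_coef s g : F^o :=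
  lin_eval (fun w : mon => (perm_eq (w : seq nat) s)%:R : F^o) (fpoly_val g).

Lemma perm_coef_linear s : linear (perm_coef s).
Proof. by move=> k f g; apply: lin_evalP. Qed.

Lemma perm_coef_word s w : w != [::] -> perm_coef s (word w) = (perm_eq w s)%:R.
Proof. by move=> w0; rewrite /perm_coef val_word // lin_evalU scale1r. Qed.

Lemma word_cat u v : u != [::] -> v != [::] -> word u ** word v = word (u ++ v).
Proof. by move=> u0 v0; rewrite word_eval_cat. Qed.

Lemma nmul_linearl y : linear (fun x : fpoly F => x ** y).
Proof. by move=> k x x'; rewrite nmulDl nscalerAl. Qed.

Lemma nmul_linearr y : linear (fun x : fpoly F => y ** x).
Proof. by move=> k x x'; rewrite nmulDr -nscalerAr. Qed.

Lemma linear_comp (U V W : lmodType F) (a : U -> V) (b : V -> W) :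
  linear a -> linear b -> linear (fun x => b (a x)).
Proof. by move=> la lb k x y; rewrite la lb. Qed.

Lemma perm_coef_mul_word s g v : v != [::] ->
  perm_coef s (g ** word v) = \sum_(u <- msupp (fpoly_val g))
    mcoeff u (fpoly_val g) * (perm_eq (u ++ v) s)%:R.
Proof.
move=> v0.
rewrite (linear_words g (linear_comp (nmul_linearl (word v)) (@perm_coef_linear s))).
rewrite big_seq [RHS]big_seq; apply: eq_bigr => u /fpoly_supp u0.
rewrite word_cat // perm_coef_word //.
by case: u u0 => -[].
Qed.

Lemma perm_coefC s f g : perm_coef s (f ** g) = perm_coef s (g ** f).
Proof.
rewrite [LHS](linear_words g (linear_comp (nmul_linearr f) (@perm_coef_linear s))).
rewrite [RHS](linear_words g (linear_comp (nmul_linearl f) (@perm_coef_linear s))).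
apply: eq_big_seq => v /fpoly_supp v0; suff -> : perm_coef s (f ** word v) =
  perm_coef s (word v ** f) by [].
rewrite perm_coef_mul_word //.
rewrite [RHS](linear_words f
  (linear_comp (nmul_linearr (word v)) (@perm_coef_linear s))).
apply: eq_big_seq => u /fpoly_supp u0.
rewrite word_cat // perm_coef_word; last by case: v v0 => -[].
suff -> : perm_eq (v ++ u) s = perm_eq (u ++ v) s by [].
by rewrite (permPl (permEl (perm_catC _ _))).
Qed.

(** The kernel of F<X> -> C, described by coefficients: projC_null and
    ideal_relsC_null are the two inclusions. *)
Definition perm_coef_null : set (fpoly F) :=
  [set g | forall s, uniq s -> perm_coef s g = 0].

(** The coefficient of s in g times a word v is the coefficient in g of the
    complement of v in s, which is again square-free. *)
Lemma perm_coef_null_ideal : is_ideal perm_coef_null.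
Proof.
have pM x y : perm_coef_null x -> perm_coef_null (x ** y).
  move=> Nx s us.
  rewrite (linear_words y (linear_comp (nmul_linearr x) (@perm_coef_linear s))).
  rewrite big_seq big1 // => v /fpoly_supp v0.
  apply/eqP; rewrite scaler_eq0; apply/orP; right.
  rewrite perm_coef_mul_word //.
  have [[t pt]|nt] := pselect (exists t, perm_eq (t ++ v) s); last first.
    apply/eqP; rewrite big1 // => u _; case: (boolP (perm_eq _ _)) => [pu|_].
      by case: nt; exists (u : seq nat).
    by rewrite mulr0.
  have ut : uniq t by move: us; rewrite -(perm_uniq pt) cat_uniq => /and3P[].
  apply/eqP; apply: etrans (Nx t ut); apply: eq_bigr => u _.
  by rewrite -(permPr pt) perm_cat2r.
split.
- by move=> s _; apply: lin_eval0.
- move=> x y Nx Ny s us; rewrite /perm_coef [LHS]lin_evalD.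
  by rewrite [X in X + _]Nx // [X in _ + X]Ny // addr0.
- move=> k x Nx s us; have := perm_coef_linear s k x 0.
  by rewrite Nx // !addr0 [perm_coef s 0]lin_eval0 addr0 scaler0.
- by move=> x y Nx; split; [apply: pM | move=> s us; rewrite perm_coefC; apply: pM].
Qed.

Lemma relsC_null : @relsC F `<=` perm_coef_null.
Proof.
move=> _ [[i [j ->]]|[i ->]] s us.
  rewrite addrC -scaleN1r [LHS]perm_coef_linear [X in _ + X]perm_coefC scaleN1r.
  exact: addNr.
rewrite [fvar F i ** _](_ : _ = word [:: i; i]) // perm_coef_word //.
case: (boolP (perm_eq _ _)) => // /perm_uniq; rewrite us /= inE eqxx //.
Qed.

Lemma ideal_relsC_null : ideal_gen (@relsC F) `<=` perm_coef_null.
Proof. by move=> g; apply; [exact: perm_coef_null_ideal | exact: relsC_null]. Qed.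

Local Notation C := (algC_sqz F).
Local Notation gen := (fun i => quot_proj (@relsC F) (fvar F i)).

Lemma projC_hom : is_nuhom (quot_proj (@relsC F) : fpoly F -> C).
Proof. exact: quot_proj_hom. Qed.

Lemma projC_eq0 g : quot_proj (@relsC F) g = 0 <-> ideal_gen (@relsC F) g.
Proof. by rewrite -(nuhom0 projC_hom) quot_projP subr0. Qed.

Lemma genC_comm i j : gen i ** gen j = gen j ** gen i :> C.
Proof.
apply: ncomm_eq; rewrite -(nuhom_ncomm projC_hom); apply/projC_eq0 => I _; apply.
by left; exists i, j.
Qed.

Lemma genC_sqr i : gen i ** gen i = 0 :> C.
Proof.
rewrite -(nuhomM projC_hom); apply/projC_eq0 => I _; apply.
by right; exists i.
Qed.

Lemma algC_comm (x y : C) : ncomm x y = 0.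
Proof.
elim/quot_ind: x => g; elim/quot_ind: y => g'.
apply: (ncomm_hom_gens _ projC_hom) => i; rewrite ncommC.
rewrite (ncomm_hom_gens _ projC_hom) ?oppr0 // => j.
exact/eq_ncomm/genC_comm.
Qed.

Local Notation wordC := (word_eval (gen : nat -> C)).

Lemma wordC_perm u v : perm_eq u v -> wordC u = wordC v.
Proof.
move=> puv; apply/esym.
apply: (@catCA_perm_ind _ (fun w => wordC w = wordC u)) puv erefl => s1 s2 s3 <-.
case: s1 => [//|i s1]; case: s2 => [//|j s2].
rewrite !catA; have e : wordC ((j :: s2) ++ i :: s1) = wordC ((i :: s1) ++ j :: s2).
  by rewrite !word_eval_cat //; apply/ncomm_eq/algC_comm.
case: s3 => [|k s3]; first by rewrite !cats0.
by rewrite [LHS]word_eval_cat // [RHS]word_eval_cat // e.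
Qed.

Lemma not_uniq_perm w : ~~ uniq w -> exists i w', perm_eq w [:: i, i & w'].
Proof.
elim: w => //= j w IH; rewrite negb_and negbK => /orP[jw|/IH[i [w' p]]].
  by exists j, (rem j w); rewrite perm_cons perm_to_rem.
exists i, (j :: w'); rewrite -(perm_cons j) in p; apply: perm_trans p _.
by rewrite -[[:: j, i, i & w']]/([:: j] ++ [:: i; i] ++ w') perm_catCA.
Qed.

Lemma wordC_not_uniq w : ~~ uniq w -> wordC w = 0.
Proof.
move=> /not_uniq_perm[i [w' /wordC_perm ->]].
case: w' => [|j w']; first exact: genC_sqr.
rewrite -[[:: i, i, j & w']]/([:: i; i] ++ j :: w') word_eval_cat //.
by rewrite [wordC [:: i; i]]genC_sqr nmul0l.
Qed.

(** In C a word only depends on its letters up to order, and vanishes when a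
    letter is repeated; so the image of g is a combination of square-free
    words with coefficients perm_coef. *)
Lemma projC_null g : perm_coef_null g -> quot_proj (@relsC F) g = 0.
Proof.
move=> Ng; rewrite (nuhom_feval _ projC_hom) /feval.
rewrite (partition_big_imfset _ (fun w : mon => sort leq w)) /=.
rewrite big_seq big1 // => t /imfsetP[/= w0 _ ->].
have sE (w : mon) : (sort leq w == sort leq w0) = perm_eq (w : seq nat) (w0 : seq nat).
  by apply/eqP/(perm_sortP leq_total leq_trans anti_leq).
have [u0|n0] := boolP (uniq (w0 : seq nat)); last first.
  apply: big1 => w; rewrite sE => pw; rewrite [word_eval _ _]wordC_not_uniq ?scaler0 //.
  by rewrite (perm_uniq pw).
transitivity ((perm_coef w0 g : F) *: wordC w0); last by rewrite Ng ?scale0r.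
rewrite scaler_suml big_mkcond /=; apply: eq_bigr => w _; rewrite sE.
case: ifP => [/wordC_perm <-|_]; first by rewrite [_ *: 1]mulr1.
by rewrite [_ *: 0]mulr0 scale0r.
Qed.

Lemma wordC_neq0 s : uniq s -> s != [::] -> wordC s <> 0.
Proof.
move=> us s0; rewrite -[wordC s](word_eval_hom (fvar F) s projC_hom).
move=> /projC_eq0/ideal_relsC_null/(_ s us)/eqP.
by rewrite perm_coef_word // perm_refl oner_eq0.
Qed.
End PermCoef.

(** * Multilinear consequences of non-identities of A(C) *)

Section Consequences.
Variable F : fieldType.
Implicit Types (s u v w : seq nat) (f g : fpoly F).
Local Notation mon := {fmonom nat}.
Local Notation word := (word_eval (fvar F)).
Local Notation C := (algC_sqz F).

Definition mterm_of (c : F) w : mterm F :=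
  (c, (take (index 0%N w) w, drop (index 0%N w).+1 w)).

(** The multilinear part of g, with the letter 0 in the role of m. *)
Definition mterms s g : seq (mterm F) :=
  [seq mterm_of (mcoeff k (fpoly_val g)) k
  | k : mon <- enum_fset (msupp (fpoly_val g)) & perm_eq (k : seq nat) (0%N :: s)].

Lemma split0 w s : perm_eq w (0%N :: s) ->
  w = take (index 0%N w) w ++ 0%N :: drop (index 0%N w).+1 w.
Proof.
move=> /perm_mem/(_ 0%N); rewrite mem_head => w0.
rewrite -[LHS](cat_take_drop (index 0%N w)); congr (_ ++ _).
by rewrite (drop_nth 0%N) ?index_mem // nth_index.
Qed.

Lemma split0_perm w s : perm_eq w (0%N :: s) ->
  perm_eq (take (index 0%N w) w ++ drop (index 0%N w).+1 w) s.
Proof.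
move=> p; rewrite -(perm_cons 0%N) -(permPr p) [X in perm_eq _ X](split0 p).
by rewrite -cat1s perm_catCA.
Qed.

Lemma mterms_multilinear s g : multilinear s (mterms s g).
Proof.
apply/allP => _ /mapP[k + ->]; rewrite mem_filter => /andP[p _] /=.
exact: split0_perm.
Qed.

Lemma meval_mterms (A : nualgType F) s g (x : nat -> A) m : uniq (0%N :: s) ->
  meval x m (mterms s g) = component (fun w => perm_eq w (0%N :: s)) (subst x 0%N m) g.
Proof.
move=> us; rewrite /meval /mterms big_map big_filter; apply: eq_bigr => k p /=.
congr (_ *: _); rewrite [in RHS](split0 p) word_eval_split substE /mterm_eval /=.
have : uniq (k : seq nat) by rewrite (perm_uniq p).
rewrite [X in uniq X](split0 p) cat_uniq /= negb_or.
move=> /and3P[_ /andP[i1 _] /andP[i2 _]].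
by rewrite leftact_subst // rightact_subst.
Qed.

(** In the second coordinate, evaluation at this assignment keeps exactly the
    words in which the letter 0 occurs once, at the end: these are the ones
    counted by lead. *)
Definition marked (i : nat) : algA (fpoly F) :=
  if i == 0%N then (0, fvar F 0) else (fvar F i, 0).

Definition ends0 w : bool := (index 0%N w).+1 == size w.

Lemma marked_word w : w != [::] ->
  word_eval marked w = (if 0%N \in w then 0 else word w, if ends0 w then word w else 0).
Proof.
elim/last_ind: w => // w i IH _; have [->|w0] := eqVneq w [::].
  by rewrite /= /marked inE /ends0 /= [0%N == i]eq_sym; case: eqP => [->|].
have e : word_eval marked (rcons w i) = ((word_eval marked w).1 ** (marked i).1,
  (word_eval marked w).1 ** (marked i).2) by rewrite word_eval_rcons.
rewrite e IH //= mem_rcons inE /ends0 -cats1 index_cat size_cat /= addn1 eqSS /marked.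
rewrite [0%N == i]eq_sym; case: ifP => w0n.
  rewrite !nmul0l orbT; congr (_, _); case: eqP => // ew.
  by move: w0n; rewrite -index_mem ew ltnn.
rewrite orbF cats1 word_eval_rcons //; case: eqP => [->|_] /=.
  by rewrite nmul0r addn0 eqxx.
by rewrite nmul0r addn1 eqn_leq ltnn.
Qed.

Lemma ends0_drop w s : perm_eq w (0%N :: s) ->
  (drop (index 0%N w).+1 w == [::]) = ends0 w.
Proof.
move=> /perm_mem/(_ 0%N); rewrite mem_head -index_mem => iw.
by rewrite -size_eq0 size_drop subn_eq0 /ends0 eqn_leq iw.
Qed.

Lemma lead_mterms s g :
  lead (mterms s g) = perm_coef (0%N :: s) (feval marked g).2.
Proof.
have l2 : linear (fun g => (feval marked g).2).
  by move=> k x y; rewrite (nuhomD (feval_hom marked)) (nuhomZ (feval_hom marked)).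
rewrite [RHS](linear_words g (linear_comp l2 (@perm_coef_linear _ _))).
rewrite /lead big_map big_filter_cond [LHS]big_mkcond big_seq [RHS]big_seq.
apply: eq_bigr => k /fpoly_supp k0 /=.
rewrite (word_eval_hom _ _ (feval_hom marked)).
have -> : feval marked \o fvar F = marked by apply/funext => i; apply: feval_var.
rewrite marked_word //=; case: (boolP (perm_eq _ _)) => [p|np] /=.
  rewrite (ends0_drop p); case: ifP => _.
    by rewrite perm_coef_word // p [_ *: 1]mulr1.
  by rewrite [perm_coef _ 0]lin_eval0 scaler0.
case: ifP => _; last by rewrite [perm_coef _ 0]lin_eval0 scaler0.
by rewrite perm_coef_word // (negPf np) scaler0.
Qed.

(** Frees the letter 0, which is then used as a marker. *)
Definition shift : fpoly F -> fpoly F := feval (fun i => fvar F i.+1).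

Lemma shift_hom : is_nuhom shift.
Proof. exact: feval_hom. Qed.

Lemma shift_word w : shift (word w) = word (map S w).
Proof.
rewrite (word_eval_hom _ _ shift_hom).
have -> : shift \o fvar F = (fun i => fvar F i.+1).
  by apply/funext => i; apply: feval_var.
elim/last_ind: w => // w i IH; have [->//|w0] := eqVneq w [::].
rewrite map_rcons !word_eval_rcons ?IH //.
by case: w w0 {IH}.
Qed.

Lemma shift_mark_linear : linear (fun x : fpoly F => shift x ** fvar F 0).
Proof.
apply: (linear_comp (a := shift) _ (nmul_linearl _)) => k x y.
by rewrite (nuhomD shift_hom) (nuhomZ shift_hom).
Qed.

Lemma perm_coef_shift s g :
  perm_coef (0%N :: map S s) (shift g ** fvar F 0) = perm_coef s g.
Proof.
rewrite [LHS](linear_words g (linear_comp shift_mark_linear (@perm_coef_linear _ _))).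
rewrite [RHS](linear_words g (@perm_coef_linear _ s)).
apply: eq_big_seq => k /fpoly_supp k0; congr (_ *: _).
have m0 : map S k != [::] by case: (fmonom_val k) k0.
rewrite shift_word -[fvar F 0]/(word [:: 0%N]) word_cat // !perm_coef_word //.
  rewrite cats1 perm_rcons perm_cons.
  suff -> : perm_eq (map S k) (map S s) = perm_eq k s by [].
  by apply/idP/idP => [/(perm_map_inj succn_inj)|/(perm_map S)].
by case: (map S k) m0.
Qed.

Lemma feval_marked_shift g : feval marked (shift g) = (shift g, 0).
Proof.
have hom1 : is_nuhom (fun u : fpoly F => (u, 0) : algA (fpoly F)).
  split=> [k x y|x y].
    by rewrite -[RHS]/(k *: x + y, k *: 0 + 0) scaler0 addr0.
  by rewrite -[RHS]/(x ** y, x ** 0) nmul0r.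
rewrite /shift (feval_nuhom _ _ (feval_hom marked)) (feval_nuhom _ _ hom1).
by apply: eq_feval => i /=; rewrite feval_var.
Qed.

Lemma marked_consequence f g G : infinite_set [set: F] ->
  (forall A : nualgType F, identity_of A f -> identity_of A g) ->
  (feval marked g).2 = shift G ** fvar F 0 -> ~ perm_coef_null G ->
  exists s (d : seq (mterm F)), [/\ uniq s, multilinear s d, lead d != 0 &
    forall A : nualgType F, identity_of A f -> kills d (@setT A)].
Proof.
move=> infF fg e /existsNP[s /not_implyP[us Gs]].
have us' : uniq (0%N :: map S s).
  by rewrite /= map_inj_uniq ?us ?andbT; [apply/mapP => -[] | apply: succn_inj].
exists (map S s), (mterms (map S s) g); split.
- by case/andP: us'.
- exact: mterms_multilinear.
- by rewrite lead_mterms e perm_coef_shift; apply/eqP.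
- move=> A /fg idg x m _; rewrite meval_mterms //.
  exact: multilinear_component.
Qed.

Lemma rowmat_map_hom (A B : nualgType F) (h h' : A -> B) :
  is_nuhom h -> linear h' -> (forall x y, h' (x ** y) = h x ** h' y) ->
  is_nuhom (fun r : algA A => (h r.1, h' r.2) : algA B).
Proof.
move=> hh lh' mh'; split=> [k x y|x y].
  rewrite -[RHS]/(k *: h x.1 + h y.1, k *: h' x.2 + h' y.2).
  by rewrite -(nuhomZ hh) -(nuhomD hh) -lh'.
by rewrite -[RHS]/(h x.1 ** h y.1, h x.1 ** h' y.2) -(nuhomM hh) -mh'.
Qed.

(** Lift a nonzero value of f on A(C) to r = f(U, V) in the algebra algA of
    F<X>. If r.2 is nonzero in C, take f at x_i = U_i + V_i x_0, where U and V
    are shifted to avoid the letter 0: its monomials ending in x_0 are those of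
    r.2 x_0. If r.1 is nonzero, f(U) x_0 does the same. *)
Lemma multilinear_consequence f : infinite_set [set: F] ->
  ~ identity_of (algA C) f ->
  exists s (d : seq (mterm F)), [/\ uniq s, multilinear s d, lead d != 0 &
    forall A : nualgType F, identity_of A f -> kills d (@setT A)].
Proof.
move=> infF /existsNP[a fa0].
pose U i := quot_repr (a i).1; pose V i := quot_repr (a i).2.
pose r := feval (fun i => (U i, V i) : algA (fpoly F)) f.
have [pl pm] := projC_hom F.
have ra : feval a f = (quot_proj (@relsC F) r.1, quot_proj (@relsC F) r.2).
  have hh := rowmat_map_hom (projC_hom F) pl pm.
  apply/esym; apply: etrans (feval_nuhom _ f hh) _; apply: eq_feval => i /=.
  by rewrite !quot_proj_repr -surjective_pairing.
have rU : r.1 = feval U f.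
  have h1 : is_nuhom (fun r : algA (fpoly F) => r.1) by split.
  by rewrite [LHS](feval_nuhom _ _ h1).
have [N1|N1] := pselect (perm_coef_null r.1); last first.
  apply: (@marked_consequence f (shift (feval U f) ** fvar F 0)) N1 => //.
    move=> A idf b; rewrite (nuhomM (feval_hom b)) /shift.
    rewrite !(feval_nuhom _ _ (feval_hom _)).
    by rewrite idf nmul0l.
  rewrite (nuhomM (feval_hom marked)) feval_marked_shift feval_var rU.
  by rewrite /marked /=.
have [N2|N2] := pselect (perm_coef_null r.2).
  by case: fa0; rewrite ra (projC_null N1) (projC_null N2).
pose X i := shift (U i) + shift (V i) ** fvar F 0.
apply: (@marked_consequence f (feval X f)) N2 => //.
  by move=> A idf b; rewrite (feval_nuhom _ _ (feval_hom b)).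
have ms (x y : fpoly F) : shift (x ** y) ** fvar F 0 = shift x ** (shift y ** fvar F 0).
  by rewrite (nuhomM shift_hom) nmulA.
have hh := rowmat_map_hom shift_hom shift_mark_linear ms.
suff -> : feval marked (feval X f) = (shift r.1, shift r.2 ** fvar F 0) by [].
apply/esym; apply: etrans (feval_nuhom _ f hh) _.
rewrite (feval_nuhom _ _ (feval_hom marked)); apply/esym.
apply: eq_feval => i /=.
rewrite (nuhomD (feval_hom marked)) (nuhomM (feval_hom marked)).
rewrite !feval_marked_shift feval_var; congr (_, _); rewrite /= /marked /=.
  by rewrite nmul0r addr0.
by rewrite add0r.
Qed.
End Consequences.

(** * The opposite algebra *)

Section Reversal.
Variable F : fieldType.
Implicit Types (f : fpoly F).

(** The image of f under the anti-automorphism of F<X> fixing the variables. *)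
Definition frev f : fpoly F := \sum_(w <- msupp (fpoly_val f))
  mcoeff w (fpoly_val f) *: word_eval (fvar F) (rev w).

Lemma word_eval_opp (A : nualgType F) (a : nat -> A) w :
  @word_eval F (algOpp A) a w = word_eval a (rev w).
Proof.
elim/last_ind: w => // w i IH; have [->//|w0] := eqVneq w [::].
rewrite rev_rcons -cat1s word_eval_cat //; last by rewrite -size_eq0 size_rev size_eq0.
by rewrite word_eval_rcons // IH.
Qed.

Lemma feval_frev (A : nualgType F) (a : nat -> A) f :
  @feval F (algOpp A) a (frev f) = feval a f.
Proof.
rewrite [LHS](nuhom_sum (@feval_hom F (algOpp A) a)); apply: eq_bigr => w _.
rewrite [LHS](nuhomZ (@feval_hom F (algOpp A) a)); congr (_ *: _).
rewrite [LHS](word_eval_hom _ _ (@feval_hom F (algOpp A) a)).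
have -> : @feval F (algOpp A) a \o @fvar F = a.
  by apply/funext => i; apply: (@feval_var F (algOpp A)).
by rewrite [LHS]word_eval_opp revK.
Qed.

Lemma multilinear_consequence_opp f : infinite_set [set: F] ->
  ~ identity_of (algOpp (algA (algC_sqz F))) f ->
  exists s (d : seq (mterm F)), [/\ uniq s, multilinear s d, lead d != 0 &
    forall A : nualgType F, identity_of A f -> @kills F (algOpp A) d setT].
Proof.
move=> infF nf; have [|s [d [us ml ld kd]]] := @multilinear_consequence F (frev f) infF.
  move=> idf; apply: nf => a; rewrite -[LHS]feval_frev.
  exact: (idf a).
exists s, d; split=> // A idf; apply: kd => a.
by rewrite [LHS]feval_frev idf.
Qed.

End Reversal.

(** * The algebra A(C) and the varieties generated by it and its opposite *)

Section RowAlgebra.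
Variable F : fieldType.
Local Notation C := (algC_sqz F).
Local Notation B := (algA C).

Lemma algA_comm_l (a b c : B) : ncomm a b ** c = 0.
Proof.
have e : (ncomm a b).1 = 0 by apply: algC_comm a.1 b.1.
rewrite -[LHS]/((ncomm a b).1 ** c.1, (ncomm a b).1 ** c.2) e.
by rewrite !nmul0l.
Qed.

(** Taking commutators of (0, c_0) with (c_1, 0), ..., (c_n, 0) in turn gives
    (0, c_0 ... c_n) up to sign, and this is never zero. *)
Lemma algA_not_lie_nil : ~ lie_nil B.
Proof.
pose c (i : nat) : C := quot_proj (@relsC F) (fvar F i).
have step n : exists k : F, k != 0 /\
    lie_value n ((0, k *: word_eval c (iota 0 n.+1)) : B).
  elim: n => [|n [k [k0 vn]]]; first by exists 1; rewrite oner_eq0.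
  exists (- k); rewrite oppr_eq0; split=> //.
  have -> : ((0, - k *: word_eval c (iota 0 n.+2)) : B) =
      ncomm ((0, k *: word_eval c (iota 0 n.+1)) : B) ((c n.+1, 0) : B).
    set v := k *: _.
    rewrite -[RHS]/(0 ** c n.+1 - c n.+1 ** 0, 0 ** 0 - c n.+1 ** v).
    rewrite !nmul0l nmul0r subrr sub0r; congr (_, _).
    rewrite scaleNr; congr (- _); rewrite -[iota 0 n.+2]/(iota 0 (n.+1).+1).
    rewrite -addn1 iotaD cats1 word_eval_rcons // /v -nscalerAr.
    by congr (_ *: _); apply/ncomm_eq/algC_comm.
  exact: lie_valueS.
move=> [n h]; have [k [k0 /h /(congr1 snd) /= /eqP]] := step n.
rewrite scaler_eq0 (negPf k0) /= => /eqP.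
exact: (wordC_neq0 (iota_uniq 0 n.+1)).
Qed.
End RowAlgebra.

Section Characterization.
Variable F : fieldType.
Implicit Types (V W : algclass F) (B : nualgType F).

(** Minimality is applied to the intersection of V with a variety containing B. *)
Lemma almost_lie_nilpotent_generated V B : is_variety V -> V B -> ~ lie_nil B ->
  almost_lie_nilpotent V -> generated_by V B.
Proof.
move=> vV VB nB [_ minV]; split=> // W vW WB.
have [//|nVW] := pselect (subclass V W).
case: nB; apply: (@lie_nilpotent_alg _ (fun A => V A /\ W A)) => //.
apply: minV => [|A []//|h]; last by apply: nVW => A /h[].
have [S VS] := vV; have [S' WS] := vW; exists (S `|` S') => A; split.
  by move=> [/VS hV /WS hW] f [/hV|/hW].
by move=> h; split; [apply/VS|apply/WS] => f Sf; apply: h; [left|right].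
Qed.

Lemma variety_not_mem V B : is_variety V -> ~ V B ->
  exists f, T_of V f /\ ~ identity_of B f.
Proof.
move=> [S VS] nVB; apply: contrapT => /forallNP h; apply: nVB; apply/VS => f Sf.
apply: contrapT => nf; apply: (h f); split=> // A /VS; exact.
Qed.

Lemma generated_almost_lie_nilpotent V B : generated_by V B -> ~ lie_nil B ->
  (forall f, ~ identity_of B f ->
     forall W, subclass W V -> T_of W f -> lie_nil (free_alg W)) ->
  almost_lie_nilpotent V.
Proof.
move=> [vV VB gV] nB h; split=> [/lie_nilpotent_alg/(_ VB)//|W vW WV nVW].
have nWB : ~ W B by move=> /(gV W vW).
have [f [Wf nf]] := variety_not_mem vW nWB.
by apply/lie_nilpotentP; apply: (h f nf).
Qed.

Lemma identity_generated V B g : generated_by V B -> identity_of B g -> T_of V g.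
Proof.
move=> [_ _ gV] Bg A VA; apply: (gV (fun A => identity_of A g)) => //.
exists [set g] => A'; split=> [ig _ ->//|]; exact.
Qed.

Definition left_comm_poly : fpoly F := ncomm (fvar F 0) (fvar F 1) ** fvar F 2.
Definition right_comm_poly : fpoly F := fvar F 2 ** ncomm (fvar F 0) (fvar F 1).

Lemma feval_left_comm_poly (A : nualgType F) (a : nat -> A) :
  feval a left_comm_poly = ncomm (a 0) (a 1) ** a 2.
Proof. by rewrite (nuhomM (feval_hom a)) (nuhom_ncomm (feval_hom a)) !feval_var. Qed.

Lemma feval_right_comm_poly (A : nualgType F) (a : nat -> A) :
  feval a right_comm_poly = a 2 ** ncomm (a 0) (a 1).
Proof. by rewrite (nuhomM (feval_hom a)) (nuhom_ncomm (feval_hom a)) !feval_var. Qed.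

Definition assign3 (A : nualgType F) (a b c : A) (i : nat) : A :=
  if i is j.+1 then (if j is 0 then b else c) else a.
End Characterization.

Theorem theorem1 (F : fieldType) (p : nat) (V : algclass F) :
  infinite_set [set: F] -> p \in [pchar F] ->
  is_variety V -> ~ prime_variety V ->
  almost_lie_nilpotent V <->
  generated_by V (algA (algC_sqz F)) \/ generated_by V (algOpp (algA (algC_sqz F))).
Proof.
move=> infF _ vV nprV; set B := algA (algC_sqz F).
have nB : ~ lie_nil B by apply: algA_not_lie_nil.
have nB' : ~ lie_nil (algOpp B) by move/lie_nil_opp.
split=> [aV|[gV|gV]].
- have [VB|/(variety_not_mem vV)[f [Tf nf]]] := pselect (V B).
    by left; apply: almost_lie_nilpotent_generated.
  have [VB|/(variety_not_mem vV)[g [Tg ng]]] := pselect (V (algOpp B)).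
    by right; apply: almost_lie_nilpotent_generated.
  have [s [d [us mld ld kd]]] := multilinear_consequence infF nf.
  have [s' [d' [us' mld' ld' kd']]] := multilinear_consequence_opp infF ng.
  have [nV _] := aV; case: nV; apply/lie_nilpotentP.
  have [M [N [[eM nM] [eN nN] MN]]] := nonprime_ideals nprV.
  apply: (nonprime_lie_nil (almost_lie_nilpotent_absorb vV aV)
    us mld ld _ us' mld' ld' _ eM nM eN nN MN).
    exact/kd/free_alg_identity.
  exact/kd'/free_alg_identity.
- apply: (generated_almost_lie_nilpotent gV nB) => f nf W WV Wf.
  have [s [d [us mld ld kd]]] := multilinear_consequence infF nf.
  have Tl : T_of V (left_comm_poly F).
    by apply: identity_generated gV _ => a; rewrite feval_left_comm_poly algA_comm_l.
  apply: (kills_lie_nil _ us mld ld); last exact/kd/free_alg_identity.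
  move=> a b c; have /free_alg_identity/(_ (assign3 a b c)) : T_of W (left_comm_poly F).
    by move=> A /WV; apply: Tl.
  by rewrite feval_left_comm_poly.
- apply: (generated_almost_lie_nilpotent gV nB') => f nf W WV Wf.
  have [s [d [us mld ld kd]]] := multilinear_consequence_opp infF nf.
  have Tr : T_of V (right_comm_poly F).
    apply: identity_generated gV _ => a; rewrite feval_right_comm_poly ncomm_opp.
    change (@nmul F B (- @ncomm F B (a 0) (a 1)) (a 2) = 0).
    by rewrite nmulNl algA_comm_l oppr0.
  apply/lie_nil_opp; apply: (kills_lie_nil _ us mld ld).
    2: exact/kd/free_alg_identity.
  move=> a b c.
  have /free_alg_identity/(_ (assign3 a b c)) : T_of W (right_comm_poly F).
    by move=> A /WV; apply: Tr.
  rewrite feval_right_comm_poly ncomm_opp => e.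
  change (@nmul F (free_alg W) c (- @ncomm F (free_alg W) a b) = 0).
  by rewrite nmulNr e oppr0.
Qed.
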